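(* Let $\alpha\in P(X)$ be a G-Pfaffian and let $\Delta_\alpha$ be the simplicial complex associated with $I_\alpha(X)$. Then $\Delta_\alpha$ is shellable.
   Context: Let $K$ be a field, $X=(X_{ij})$ a skew-symmetric $n\times n$ matrix of indeterminates, and $R=K[X]=K[X_{ij}: 1\le i<j\le n]$. For $1\le a_1<\dots<a_{2t}\le n$, $t\ge1$, $[a_1,\ldots,a_{2t}]$ denotes the Pfaffian of the skew-symmetric submatrix of $X$ with row and column indices $a_1,\ldots,a_{2t}$. $P(X)$ is the set of all Pfaffians of $X$, partially ordered by: $[a_1,\ldots,a_{2t}]\le[b_1,\ldots,b_{2s}]$ iff $t\ge s$ and $a_i\le b_i$ for $i=1,\ldots,2s$. The ideal cogenerated by $\alpha\in P(X)$ is $I_\alpha(X)=(\beta\in P(X): \beta\not\ge\alpha)\subset R$. A term order on $R$ is anti-diagonal if the initial monomial of every Pfaffian $[a_1,\ldots,a_{2t}]$ is $X_{a_1a_{2t}}X_{a_2a_{2t-1}}\cdots X_{a_ta_{t+1}}$. $\alpha$ is called a G-Pfaffian (and $I_\alpha(X)$ a G-Pfaffian ideal) if the natural generators $\{\beta\in P(X):\beta\not\ge\alpha\}$ form a Gröbner basis of $I_\alpha(X)$ with respect to every anti-diagonal term order. Let $X_+=\{(i,j):1\le i<j\le n\}$. The simplicial complex $\Delta_\alpha$ associated with $I_\alpha(X)$ is the family of all subsets $Z\subseteq X_+$ such that $\prod_{(i,j)\in Z}X_{ij}\notin\operatorname{in}(I_\alpha(X))$, the initial ideal being taken with respect to an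 anti-diagonal term order. Shellability is for pure complexes: the facets can be totally ordered so that for any two facets $F\succ F'$ there exist $x\in F\setminus F'$ and a facet $F''$ with $F\succ F''$ and $F\setminus F''=\{x\}$. *)

(* Defs.v *)
From HB Require Import structures.
From mathcomp Require Import all_boot all_order all_algebra all_fingroup.
From mathcomp Require Import mpoly.

Set Implicit Arguments.
Unset Strict Implicit.
Unset Printing Implicit Defensive.

Import GRing.Theory.
Local Open Scope ring_scope.

Section Pfaffian.
Variables (R : comNzRingType) (t : nat).

Definition ord_even (k : 'I_t) : 'I_(t.*2) :=
  Ordinal (etrans (ltn_double k t) (ltn_ord k)).
Definition ord_odd (k : 'I_t) : 'I_(t.*2) :=
  Ordinal (etrans (ltn_Sdouble k t) (ltn_ord k)).

(* The permutations s with s(2k) < s(2k+1) and s(0) < s(2) < s(4) < ... are in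
   bijection with the perfect matchings of 'I_(2t). *)
Definition matching_perm (s : 'S_(t.*2)) : bool :=
  [forall k, (s (ord_even k) < s (ord_odd k))%N] &&
  [forall k : 'I_t, forall l : 'I_t,
     (k < l)%N ==> (s (ord_even k) < s (ord_even l))%N].

(* Summing over matchings, rather than over all permutations with a factor
   1 / (2^t t!), makes the definition valid in every characteristic. *)
Definition pfaffian (A : 'M[R]_(t.*2)) : R :=
  \sum_(s : 'S_(t.*2) | matching_perm s)
     (-1) ^+ s * \prod_(k < t) A (s (ord_even k)) (s (ord_odd k)).

End Pfaffian.

Section Groebner.
Variables (K : fieldType) (m : nat).
Implicit Types (ord : rel 'X_{1..m}) (p f g : {mpoly K[m]}).
Implicit Types (I G : {mpoly K[m]} -> Prop).

Definition ideal_gen (S : {mpoly K[m]} -> Prop) f : Prop :=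
  exists2 s : seq ({mpoly K[m]} * {mpoly K[m]}),
    forall cg, cg \in s -> S cg.2 & f = \sum_(cg <- s) cg.1 * cg.2.

Definition term_order ord : Prop :=
  [/\ total ord, antisymmetric ord, transitive ord,
      forall u, ord 0%MM u
    & forall u v w, ord u v -> ord (u + w)%MM (v + w)%MM].

Definition is_initial_monomial ord p (u : 'X_{1..m}) : Prop :=
  u \in msupp p /\ forall v, v \in msupp p -> ord v u.

Definition initial_monomials ord (S : {mpoly K[m]} -> Prop) f : Prop :=
  exists g u, [/\ S g, is_initial_monomial ord g u & f = 'X_[u]].

Definition initial_ideal ord I : {mpoly K[m]} -> Prop :=
  ideal_gen (initial_monomials ord I).

Definition groebner_basis ord G I : Prop :=
  (forall g, G g -> I g) /\
  (forall f, initial_ideal ord I f <-> ideal_gen (initial_monomials ord G) f).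

End Groebner.

Section Complex.
Variable T : finType.
Implicit Types (D : {set T} -> Prop) (F Z : {set T}).

Definition facet D F : Prop :=
  D F /\ forall Z, D Z -> F \subset Z -> Z = F.

Definition pure D : Prop :=
  forall F F', facet D F -> facet D F' -> #|F| = #|F'|.

(* The list s enumerates the facets in increasing order. *)
Definition shellable D : Prop :=
  pure D /\
  exists s : seq {set T},
    [/\ uniq s, forall F, F \in s <-> facet D F
      & forall F F', F \in s -> F' \in s -> (index F' s < index F s)%N ->
          exists x F'', [/\ x \in F :\: F', F'' \in s,
                            (index F'' s < index F s)%N
                          & F :\: F'' = [set x]]].

End Complex.

Definition Xplus (n : nat) : finType := {e : 'I_n * 'I_n | (e.1 < e.2)%N}.

Notation polyX K n := {mpoly K[#|Xplus n|]}.

Definition Xvar (K : fieldType) (n : nat) (e : Xplus n) : polyX K n :=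
  'X_(enum_rank e).

Definition Xmx (K : fieldType) (n : nat) : 'M[polyX K n]_n :=
  \matrix_(i, j)
    if insub (i, j) is Some e then Xvar K e
    else if insub (j, i) is Some e then - Xvar K e
    else 0.

(* The index sequence [a_1, ..., a_{2t}] of a Pfaffian of X; distinct index
   sequences give distinct Pfaffians, so this type also stands for P(X). *)
Record pf_index (n : nat) := PfIndex {
  pf_half : nat;
  pf_seq : (pf_half.*2).-tuple 'I_n;
  pf_half_gt0 : (0 < pf_half)%N;
  pf_seq_incr : forall i j : 'I_(pf_half.*2),
    (i < j)%N -> (tnth pf_seq i < tnth pf_seq j)%N }.

Section CogeneratedIdeals.
Variables (K : fieldType) (n : nat).
Implicit Types a b alpha : pf_index n.

Definition pf a : polyX K n :=
  pfaffian (\matrix_(i, j) Xmx K n (tnth (pf_seq a) i) (tnth (pf_seq a) j)).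

Definition pf_le a b : Prop :=
  (pf_half b <= pf_half a)%N /\
  forall (i : 'I_((pf_half a).*2)) (j : 'I_((pf_half b).*2)),
    i = j :> nat -> (tnth (pf_seq a) i <= tnth (pf_seq b) j)%N.

Definition natural_generators alpha (f : polyX K n) : Prop :=
  exists2 b, ~ pf_le alpha b & f = pf b.

Definition cogenerated_ideal alpha : polyX K n -> Prop :=
  ideal_gen (natural_generators alpha).

Definition antidiagonal_product a : polyX K n :=
  \prod_(i < (pf_half a).*2 | (i < pf_half a)%N)
     Xmx K n (tnth (pf_seq a) i) (tnth (pf_seq a) (rev_ord i)).

Definition antidiagonal (ord : rel 'X_{1..#|Xplus n|}) : Prop :=
  term_order ord /\
  forall a, exists2 u, 'X_[u] = antidiagonal_product a
                     & is_initial_monomial ord (pf a) u.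

Definition G_pfaffian alpha : Prop :=
  forall ord, antidiagonal ord ->
    groebner_basis ord (natural_generators alpha) (cogenerated_ideal alpha).

Definition Delta ord alpha (Z : {set Xplus n}) : Prop :=
  ~ initial_ideal ord (cogenerated_ideal alpha) (\prod_(e in Z) Xvar K e).

End CogeneratedIdeals.

Arguments antidiagonal K {n} ord.
Arguments G_pfaffian K {n} alpha.
Arguments Delta K {n} ord alpha Z.
Arguments pf K {n} a.

(* Main.v *)
Require Import Defs.
From mathcomp Require Import all_boot all_order all_algebra all_fingroup.
From mathcomp Require Import mpoly zify.

Set Implicit Arguments.
Unset Strict Implicit.
Unset Printing Implicit Defensive.

(* Since alpha is a G-Pfaffian, in(I_alpha) is generated by the antidiagonals of
   the b with b not >= alpha, so Delta consists of the sets of cells containing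
   none of these antidiagonals, i.e. certain chains for the order "nested inside".

   Write alpha = [a_1, ..., a_2s]. If a_i > a_(i-1) + 1 for some 3 <= i <= 2s - 1,
   put S = (a_1, ..., a_(i-1), a_i - 1), x = a_i, y = a_(i+1), z = a_(i+2), e = a_1.
   One of
     X_ey [S x] - X_ex [S y]                                      (i odd),
     X_ex [S y z] - X_ey [S x z] + X_ez [S x y] - [S] [e x y z]   (i even)
   is a nonzero element of I_alpha none of whose monomials is divisible by such an
   antidiagonal. Hence a_2, ..., a_(2s-1) are consecutive and the faces become: cells
   in rows >= a_1 and columns >= a_2, no 2-chain in rows < a_2, no s-chain in columns
   < a_2s, no (s+1)-chain.

   If a_1 = a_2 - 1 the condition on rows < a_2 is void, and the complex is vertex
   decomposable: one removes cells row by row; the state reached is a bound g on the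
   length of chains by their outermost column, and the dimension of what remains is
   computed by an explicit sum (corank). A smaller a_1 amounts to duplicating the top
   row, which preserves shellability. *)

(** * Shellable complexes *)

(** The relations answer two demands. A Pfaffian whose indices begin with S lies in I_alpha, as its
    i-th entry is a_i - 1. Conversely, an index b not >= alpha with all entries among S and the
    letters x, y, z must begin with the whole of S; so a monomial in which a late enough entry of S
    is paired with a letter is divisible by no antidiagonal of such a b. The terms to be killed are
    those pairing e with a letter, which cancel by exchanging this letter with the one in the outer
    variable, and those pairing two letters, which [S] [e x y z] removes. The bounds on i leave room
    for a surviving term: below, e must find a partner inside S; above, the letters must be entries
    of alpha.

    For shellability the obstacle is purity. The link of a cell lowers the bound on chains only in
    the columns to its left, so a single numerical bound is not stable under links, while a bound
    depending on the outermost column is; the size of the facets must then drop by exactly one. *)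

Section Shellability.
Variable T : finType.
Implicit Types (D : {set T} -> Prop) (F Z : {set T}) (S : {set {set T}}).

(* The ranking rk stands for the position in a shelling order; unlike a list, it
   combines well under joins and products. *)
Definition ranked_shelling D (d : nat) S (rk : {set T} -> nat) : Prop :=
  [/\ forall Z, D Z <-> exists2 F, F \in S & Z \subset F,
      forall F, F \in S -> #|F| = d,
      {in S &, injective rk}
    & forall F F', F \in S -> F' \in S -> rk F' < rk F ->
        exists x F'', [/\ F'' \in S, rk F'' < rk F,
                          F :\: F'' = [set x] & x \notin F']].

Definition pure_shellable D d : Prop := exists S rk, ranked_shelling D d S rk.

Lemma eq_pure_shellable D D' d :
  (forall Z, D Z <-> D' Z) -> pure_shellable D d -> pure_shellable D' d.
Proof.
move=> eqD [S [rk [faceS cardS injS exS]]]; exists S, rk; split=> // Z.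
by rewrite -eqD.
Qed.

Lemma ranked_shelling_facet D d S rk F :
  ranked_shelling D d S rk -> facet D F <-> F \in S.
Proof.
case=> faceS cardS _ _; split=> [[/faceS[G SG sFG] maxF]|SF].
  by rewrite -(maxF G) //; apply/faceS; exists G.
split=> [|Z /faceS[G SG sZG] sFZ]; first by apply/faceS; exists F.
apply/esym/eqP; rewrite eqEcard sFZ (cardS _ SF) -(cardS _ SG).
exact: subset_leq_card.
Qed.

Lemma shellable_pure_shellable D d : pure_shellable D d -> shellable D.
Proof.
move=> [S [rk shS]]; have facetS F := ranked_shelling_facet F shS.
case: shS => _ cardS injS exS; split=> [F F' /facetS SF /facetS SF'|].
  by rewrite !cardS.
pose le_rk := relpre rk leq.
have le_tot : total le_rk by move=> x y; apply: leq_total.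
have le_tr : transitive le_rk by move=> x y z; apply: leq_trans.
pose s := sort le_rk (enum S).
have mem_s F : (F \in s) = (F \in S) by rewrite mem_sort mem_enum.
have uniq_s : uniq s by rewrite sort_uniq enum_uniq.
have sorted_s : sorted le_rk s by apply: sort_sorted.
have idx F F' : F \in S -> F' \in S -> (index F' s < index F s) = (rk F' < rk F).
  move=> SF SF'.
  have le A B : A \in S -> B \in S -> index A s <= index B s -> rk A <= rk B.
    move=> SA SB; apply: (sorted_leq_index le_tr _ sorted_s); rewrite ?mem_s //.
    by move=> x; apply: leqnn.
  case: ltngtP => [lt|lt|eqi]; apply/esym.
  - rewrite ltn_neqAle le ?(ltnW lt) // andbT; apply: contraTneq lt.
    by move=> /(injS _ _ SF' SF) ->; rewrite ltnn.
  - by rewrite ltnNge le // ltnW.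
  - have -> : F = F'; last by rewrite ltnn.
    have inF : F \in s by rewrite mem_s.
    have inF' : F' \in s by rewrite mem_s.
    by rewrite -(nth_index set0 inF) -(nth_index set0 inF') eqi.
exists s; split=> [//|F|F F']; first by rewrite mem_s facetS.
rewrite !mem_s => SF SF'; rewrite idx // => /(exS _ _ SF SF').
case=> x [F'' [SF'' lt eqx xF']]; exists x, F''; split=> //; last 2 first.
- by rewrite mem_s.
- by rewrite idx.
have: x \in F :\: F'' by rewrite eqx set11.
by rewrite !inE xF' => /andP[].
Qed.

Lemma pure_shellable_point : pure_shellable (fun Z => Z = set0) 0.
Proof.
exists [set set0], (fun=> 0); split.
- move=> Z; split=> [->|[F /set1P-> /[!subset0] /eqP//]].
  by exists set0; rewrite ?set11.
- by move=> F /set1P->; rewrite cards0.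
- by move=> F F' /set1P-> /set1P->.
- by move=> F F' _ _; rewrite ltnn.
Qed.

(** Shedding vertex: [D0] is the deletion of [x], [D1] its link. The facets of the deletion come
    first, followed by [x] joined to those of the link. Since the facets of [D0] have size [d.+1],
    no facet of the link is maximal in the deletion. *)
Lemma pure_shellable_shed (x : T) D D0 D1 d :
    (forall Z, D0 Z -> x \notin Z) -> (forall Z, D1 Z -> D0 Z) ->
    (forall Z, x \notin Z -> D Z <-> D0 Z) ->
    (forall Z, x \in Z -> D Z <-> D1 (Z :\ x)) ->
    pure_shellable D0 d.+1 -> pure_shellable D1 d -> pure_shellable D d.+1.
Proof.
move=> xD0 sD10 D_D0 D_D1 [S0 [rk0 [face0 card0 inj0 ex0]]].
move=> [S1 [rk1 [face1 card1 inj1 ex1]]].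
have x0 F : F \in S0 -> x \notin F by move=> SF; apply/xD0/face0; exists F.
have x1 F : F \in S1 -> x \notin F.
  by move=> SF; apply/xD0/sD10/face1; exists F.
(* [M] exceeds all ranks in the deletion, so the facets through [x] come last. *)
pose M := (\max_(F in S0) rk0 F).+1.
have ltM F : F \in S0 -> rk0 F < M by move=> SF; rewrite ltnS leq_bigmax_cond.
pose S := S0 :|: [set x |: F | F in S1].
pose rk F := if x \in F then M + rk1 (F :\ x) else rk0 F.
have SP F : F \in S -> (F \in S0 /\ rk F = rk0 F) \/
    exists G, [/\ G \in S1, F = x |: G, x \notin G & rk F = M + rk1 G].
  case/setUP=> [SF|/imsetP[G SG ->]]; [left|right].
    by rewrite /rk (negPf (x0 _ SF)).
  by exists G; rewrite /rk setU11 setU1K x1.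
have S0S F : F \in S0 -> F \in S by rewrite inE => ->.
have S1S G : G \in S1 -> x |: G \in S by move=> SG; rewrite inE imset_f ?orbT.
have rk0E F : F \in S0 -> rk F = rk0 F by move=> SF; rewrite /rk (negPf (x0 _ SF)).
have rk1E G : G \in S1 -> rk (x |: G) = M + rk1 G.
  by move=> SG; rewrite /rk setU11 setU1K ?x1.
exists S, rk; split.
- move=> Z; have [xZ|xZ] := boolP (x \in Z).
    rewrite D_D1 // face1; split=> [[G SG sZG]|[F SF sZF]].
      by exists (x |: G); rewrite ?S1S // -subDset.
    have [[SF0 _]|[G [SG eqF _ _]]] := SP _ SF.
      by have := x0 _ SF0; rewrite (subsetP sZF).
    by exists G; rewrite // subDset -eqF.
  rewrite D_D0 // face0; split=> [[F SF sZF]|[F SF sZF]].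
    by exists F; rewrite ?S0S.
  have [[SF0 _]|[G [SG eqF _ _]]] := SP _ SF; first by exists F.
  have /face0[F' SF' sGF'] : D0 G by apply/sD10/face1; exists G.
  exists F' => //; apply: subset_trans sGF'; apply/subsetP=> y yZ.
  have := subsetP sZF _ yZ; rewrite eqF in_setU1 => /predU1P[eqy|//].
  by rewrite -eqy yZ in xZ.
- move=> F /SP[[SF _]|[G [SG -> xG _]]]; first exact: card0.
  by rewrite cardsU1 xG card1.
- move=> F F' SF SF' eqrk.
  have [[SF0 eF]|[G [SG eF xG rF]]] := SP _ SF;
    have [[SF0' eF']|[G' [SG' eF' xG' rF']]] := SP _ SF'.
  + by apply: inj0; rewrite // -eF -eF'.
  + by have := ltM _ SF0; rewrite -eF eqrk rF' ltnNge leq_addr.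
  + by have := ltM _ SF0'; rewrite -eF' -eqrk rF ltnNge leq_addr.
  + move: eqrk; rewrite rF rF' => /addnI /inj1 eG.
    by rewrite eF eF' eG.
- move=> F F' SF SF' ltrk.
  have [[SF0 eF]|[G [SG eF xG rF]]] := SP _ SF.
    have [[SF0' eF']|[G' [SG' eF' xG' rF']]] := SP _ SF'; last first.
      have := ltM _ SF0; rewrite -eF => /(ltn_trans ltrk).
      by rewrite rF' ltnNge leq_addr.
    rewrite eF eF' in ltrk; have [y [F'' [SF'' lt eqy yF']]] := ex0 _ _ SF0 SF0' ltrk.
    by exists y, F''; rewrite S0S // rk0E // eF.
  have [[SF0' eF']|[G' [SG' eF' xG' rF']]] := SP _ SF'.
    (* Here [F'] avoids [x]: any facet of the deletion containing the link facet [G] serves, and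
       only [x] is lost. *)
    have /face0[F'' SF'' sGF''] : D0 G by apply/sD10/face1; exists G.
    exists x, F''; split; rewrite ?S0S ?x0 //.
      by rewrite rk0E // rF (leq_trans (ltM _ SF'')) ?leq_addr.
    apply/setP=> y; rewrite eF !inE; have [->|neyx] /= := eqVneq y x.
      by rewrite x0.
    by apply/negP=> /andP[/negP yF'' /(subsetP sGF'')].
  rewrite rF rF' ltn_add2l in ltrk.
  have [y [G'' [SG'' lt eqy yG']]] := ex1 _ _ SG SG' ltrk.
  exists y, (x |: G''); split; rewrite ?S1S //.
  + by rewrite rk1E // rF ltn_add2l.
  + rewrite eF -eqy; apply/setP=> z; rewrite !inE negb_or.
    by have [->|] //= := eqVneq z x; rewrite (negPf xG) andbF.
  + have : y \in G by have := set11 y; rewrite -eqy inE => /andP[].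
    by rewrite eF' in_setU1 negb_or yG' andbT; apply: contraTneq => ->.
Qed.

Lemma pure_shellable_cone (x : T) D D0 d :
    (forall Z, D0 Z -> x \notin Z) -> (forall Z, D Z <-> D0 (Z :\ x)) ->
    pure_shellable D0 d -> pure_shellable D d.+1.
Proof.
move=> xD0 D_D0 [S0 [rk0 [face0 card0 inj0 ex0]]].
have x0 F : F \in S0 -> x \notin F by move=> SF; apply/xD0/face0; exists F.
exists [set x |: F | F in S0], (fun F => rk0 (F :\ x)); split.
- move=> Z; rewrite D_D0 face0; split=> [[F SF sZF]|[_ /imsetP[F SF ->] sZF]].
    by exists (x |: F); rewrite ?imset_f -?subDset.
  by exists F; rewrite // subDset.
- by move=> _ /imsetP[F SF ->]; rewrite cardsU1 x0 // card0.
- move=> _ _ /imsetP[F SF ->] /imsetP[F' SF' ->].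
  by rewrite !setU1K ?x0 // => /inj0->.
- move=> _ _ /imsetP[F SF ->] /imsetP[F' SF' ->].
  rewrite !setU1K ?x0 // => /(ex0 _ _ SF SF')[y [F'' [SF'' lt eqy yF']]].
  exists y, (x |: F''); split; rewrite ?imset_f ?setU1K ?x0 //.
    rewrite -eqy; apply/setP=> z; rewrite !inE negb_or.
    by have [->|] //= := eqVneq z x; rewrite (negPf (x0 _ SF)) andbF.
  have : y \in F by have := set11 y; rewrite -eqy inE => /andP[].
  rewrite in_setU1 negb_or yF' andbT; apply: contraTneq => ->.
  exact: x0.
Qed.

End Shellability.

(** * Duplication of a row *)

Section RowDoubling.
Variables (T : finType) (U V : {set T}) (iota : T -> T) (col : T -> nat).
Hypothesis iotaK : involutive iota.
Hypothesis iotaUV : forall x, (iota x \in V) = (x \in U).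
Hypothesis disjUV : forall x, x \in U -> x \notin V.
Hypothesis col_iota : forall x, x \in U -> col (iota x) = col x.
Hypothesis col_inj : {in V &, injective col}.

Let mu x := if x \in U then iota x else x.

Let iotaVU x : (iota x \in U) = (x \in V).
Proof. by rewrite -iotaUV iotaK. Qed.

Let VnU x : x \in V -> x \notin U.
Proof. by apply: contraL => /disjUV. Qed.

(** The trace of [F] on [V] is split at [v]: cells up to the column of [v] are moved to [U], cells
    from that column on stay in [V]. The column of [v] is kept in both rows, which gives one cell
    more than [F]. *)
Let G (F : {set T}) v : {set T} :=
  [set x | if x \in U then (iota x \in F) && (col x <= col v)
           else (x \in F) && ((x \in V) ==> (col v <= col x))].

(* Replacing a linearly ordered row V by the two rows U, V turns the trace of a
   facet on V into a monotone path in a 2-row grid; such a path is determined by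
   the column v in which it steps down. *)
Lemma pure_shellable_row_doubling (D D' : {set T} -> Prop) d v0 :
    (forall Z x, D Z -> x \in Z -> x \notin U) ->
    v0 \in V -> (forall x, x \in V -> col v0 <= col x) ->
    (forall Z, D Z -> D (v0 |: Z)) ->
    (forall Z, D' Z <->
       {in Z :&: U & Z :&: V, forall x y, col x <= col y} /\ D (mu @: Z)) ->
  pure_shellable D d -> pure_shellable D' d.+1.
Proof.
move=> D_U Vv0 minv0 conev0 D'E [S [rk [faceS cardS injS exS]]].
have SU F x : F \in S -> x \in F -> x \notin U.
  by move=> SF; apply: D_U; apply/faceS; exists F.
(* A cone point lies in every facet; hence every facet has a cell of [V] at which to step down. *)
have Sv0 F : F \in S -> v0 \in F.
  move=> SF; have /conev0/faceS[F' SF' sF']: D F by apply/faceS; exists F.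
  suff -> : F = F' by rewrite (subsetP sF') ?setU11.
  apply/eqP; rewrite eqEcard (cardS _ SF) (cardS _ SF') leqnn andbT.
  exact: subset_trans (subsetUr _ _) sF'.
have GU F v x : x \in U -> (x \in G F v) = (iota x \in F) && (col x <= col v).
  by move=> Ux; rewrite inE Ux.
have GV F v x : x \in V -> (x \in G F v) = (x \in F) && (col v <= col x).
  by move=> Vx; rewrite inE (negPf (VnU Vx)) Vx.
have GN F v x : x \notin U -> x \notin V -> (x \in G F v) = (x \in F).
  by move=> Ux Vx; rewrite inE (negPf Ux) (negPf Vx) andbT.
pose cond v x := if x \in U then col x <= col v else (x \in V) ==> (col v <= col x).
have GE F v x : (x \in G F v) = (mu x \in F) && cond v x.
  by rewrite inE /mu /cond; case: ifP.
have muG F v : F \in S -> mu @: G F v = F.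
  move=> SF; apply/setP=> x; apply/imsetP/idP=> [[y Gy ->]|Fx].
    rewrite /mu; move: Gy; rewrite inE.
    by case: ifP => [_ /andP[]|_ /andP[]].
  have Ux := SU _ _ SF Fx; have [Vx|Vx] := boolP (x \in V); last first.
    by exists x; rewrite ?GN // /mu (negPf Ux).
  have [le|lt] := leqP (col v) (col x).
    by exists x; rewrite ?GV ?Fx // /mu (negPf Ux).
  exists (iota x); last by rewrite /mu iotaVU Vx iotaK.
  by rewrite GU ?iotaVU // iotaK Fx -col_iota ?iotaVU // iotaK ltnW.
have cardG F v : F \in S -> v \in F -> v \in V -> #|G F v| = d.+1.
  move=> SF Fv Vv; rewrite -(cardS _ SF).
  pose A := [set x in F | (x \in V) ==> (col v <= col x)].
  pose B := [set x in F | (x \in V) && (col x <= col v)].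
  have FAB : F = A :|: B.
    apply/setP=> x; rewrite !inE -andb_orr; case: (x \in F) => //=.
    by case: (x \in V) => //=; rewrite leq_total.
  have vAB : [set v] = A :&: B.
    apply/setP=> x; rewrite !inE; apply/eqP/andP=> [->|].
      by rewrite Fv Vv leqnn.
    move=> [/andP[_ h] /and3P[_ Vx le1]]; rewrite Vx /= in h.
    by apply: col_inj => //; apply/eqP; rewrite eqn_leq le1.
  have -> : G F v = A :|: iota @: B.
    apply/setP=> x; rewrite !inE; have [Ux|Ux] := boolP (x \in U).
      rewrite (contraTF (SU _ x SF) Ux) /=.
      apply/idP/imsetP=> [/andP[Fx le]|[y]].
        exists (iota x); last by rewrite iotaK.
        by rewrite inE Fx iotaUV Ux col_iota.
      rewrite inE => /and3P[Fy Vy le] eqx.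
      by rewrite eqx iotaK Fy -col_iota ?iotaVU // iotaK.
    rewrite orbC; case: imsetP => // -[y]; rewrite inE => /and3P[_ Vy _] eqx.
    by rewrite eqx iotaVU Vy in Ux.
  have -> : #|F|.+1 = #|A| + #|B|.
    by rewrite -cardsUI -FAB -vAB cards1 addn1.
  rewrite -(card_imset B (inv_inj iotaK)) cardsU.
  suff -> : A :&: iota @: B = set0 by rewrite cards0 subn0.
  apply/setP=> x; rewrite !inE; apply/negP=> /andP[/andP[Fx _]].
  case/imsetP=> y; rewrite inE => /and3P[_ Vy _] eqx.
  by have := SU _ _ SF Fx; rewrite eqx iotaVU Vy.
(* [m] recovers the column of [v] from [G F v]. As [M] below exceeds all columns, [rk'] orders
   facets lexicographically by the rank of [F], then the column of [v]. *)
pose m (F : {set T}) := \max_(x in U :&: F) col x.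
have mG F v : F \in S -> v \in F -> v \in V -> m (G F v) = col v.
  move=> SF Fv Vv; apply/eqP; rewrite eqn_leq; apply/andP; split.
    by apply/bigmax_leqP=> x /setIP[Ux]; rewrite GU // => /andP[].
  have Uv : iota v \in U by rewrite iotaVU.
  have colv : col (iota v) = col v by rewrite -(col_iota Uv) iotaK.
  rewrite -colv /m (bigD1 (iota v)) /= ?leq_maxl //.
  by rewrite inE Uv GU // iotaK Fv colv leqnn.
pose M := (\max_x col x).+1.
have ltM x : col x < M by rewrite ltnS leq_bigmax.
pose S' := 
  [set G p.1 p.2 | p in [set p : {set T} * T | (p \in setX S V) && (p.2 \in p.1)]].
pose rk' (F : {set T}) := rk (mu @: F) * M + m F.
have S'P F : F \in S' -> exists F1 v,
    [/\ F1 \in S, v \in V, v \in F1, F = G F1 v & rk' F = rk F1 * M + col v].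
  case/imsetP=> -[F1 v] /[!inE]/= /andP[/andP[SF Vv] Fv] ->.
  by exists F1, v; rewrite /rk' muG // mG.
have S'G F v : F \in S -> v \in V -> v \in F -> G F v \in S'.
  move=> SF Vv Fv; apply/imsetP; exists (F, v) => //.
  by rewrite !inE /= SF Vv.
have rkG F v : F \in S -> v \in V -> v \in F -> rk' (G F v) = rk F * M + col v.
  by move=> SF Vv Fv; rewrite /rk' muG // mG.
have rk_lt a b x y : (a * M + col x < b * M + col y) =
    (a < b) || (a == b) && (col x < col y).
  have := ltM x; have := ltM y; move: (col x) (col y) (M) => p q N qN pN.
  case: (ltngtP a b) => [ab|ab|->] /=; last by rewrite ltn_add2l.
    rewrite (@leq_trans (a.+1 * N)) //; last first.
      by rewrite (leq_trans _ (leq_addr _ _)) ?leq_mul2r ?ab ?orbT.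
    by rewrite mulSn addnC ltn_add2r.
  apply/negbTE; rewrite -leqNgt ltnW // (@leq_trans (b.+1 * N)) //.
    by rewrite mulSn addnC ltn_add2r.
  by rewrite (leq_trans _ (leq_addr _ _)) ?leq_mul2r ?ab ?orbT.
exists S', rk'; split.
- move=> Z; rewrite D'E; split=> [[colZ /faceS[F SF sZF]]|[F' /S'P]].
    have ZF x : x \in Z -> mu x \in F by move=> Zx; rewrite (subsetP sZF) ?imset_f.
    pose P v := [&& v \in V, v \in F & [forall x in Z :&: U, col x <= col v]].
    (* Step down at the rightmost column of [Z :&: U], or at [v0] if this set is empty. *)
    have [v /and3P[Vv Fv /forall_inP vmax] vmin] : exists2 v, P v &
        {in Z :&: V, forall y, col v <= col y}.
      have [/set0Pn[x0 ZUx0]|/negPn/eqP ZU0] := boolP (Z :&: U != set0); last first.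
        exists v0 => [|y /setIP[_ /minv0]//].
        rewrite /P Vv0 Sv0 //=; apply/forall_inP=> x.
        by rewrite ZU0 inE.
      case: (@arg_maxnP _ x0 (mem (Z :&: U)) col ZUx0) => x ZUx xmax.
      have /setIP[Zx Ux] := ZUx; exists (iota x).
        rewrite /P iotaUV Ux /=; have := ZF _ Zx; rewrite /mu Ux => -> /=.
        by apply/forall_inP=> y ZUy; rewrite col_iota //; apply: xmax.
      by move=> y ZVy; rewrite col_iota // colZ.
    exists (G F v); first exact: S'G.
    apply/subsetP=> x Zx; have := ZF _ Zx; rewrite /mu inE; case: ifP => Ux ->.
      by rewrite /= vmax // inE Zx.
    by apply/implyP=> Vx; rewrite vmin // inE Zx.
  case=> [F [v [SF Vv Fv -> _]]] sZG; split=> [x y|].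
    move=> /setIP[/(subsetP sZG) Gx Ux] /setIP[/(subsetP sZG) Gy Vy].
    move: Gx Gy; rewrite GU // GV // => /andP[_ le1] /andP[_].
    exact: leq_trans.
  by apply/faceS; exists F; rewrite // -(muG F v SF) imsetS.
- by move=> F /S'P[F1 [v [SF Vv Fv -> _]]]; apply: cardG.
- move=> F F' /S'P[F1 [v [SF Vv Fv -> ->]]] /S'P[F1' [v' [SF' Vv' Fv' -> ->]]] eqr.
  have := rk_lt (rk F1) (rk F1') v v'; have := rk_lt (rk F1') (rk F1) v' v.
  rewrite eqr ltnn; case: ltngtP => //= eqrk; case: ltngtP => //= eqc _ _.
  by rewrite (injS _ _ SF SF' (esym eqrk)) (col_inj Vv Vv').
- move=> F F' /S'P[F1 [v [SF Vv Fv -> rkF]]] /S'P[F1' [v' [SF' Vv' Fv' -> rkF']]].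
  rewrite rkF rkF' rk_lt.
  have colv : col (iota v) = col v by rewrite -[in RHS](iotaK v) [in RHS]col_iota ?iotaVU.
  (* Moving the step to the nearest cell [w] of [F1] in [V] on the left loses only [iota v]. *)
  have step w0 : w0 \in F1 -> w0 \in V -> col w0 < col v ->
      exists2 w, [/\ w \in F1, w \in V, col w0 <= col w & col w < col v]
               & G F1 v :\: G F1 w = [set iota v].
    move=> Fw0 Vw0 lt0.
    pose P w := [&& w \in F1, w \in V & col w < col v].
    have Pw0 : P w0 by rewrite /P Fw0 Vw0.
    case: (@arg_maxnP _ w0 P col Pw0) => w /and3P[Fw Vw ltw] wmax.
    exists w; first by split=> //; apply: wmax.
    apply/setP=> x; rewrite in_setD in_set1.
    have [Ux|Ux] := boolP (x \in U).
      rewrite !GU //; case: (boolP (iota x \in F1)) => [Fx|Fx] /=; last first.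
        apply/esym/negbTE; apply: contraNneq Fx => ->; by rewrite iotaK.
      rewrite -ltnNge; apply/andP/eqP=> [[ltwx lexv]|->].
        apply: (can_inj iotaK); rewrite iotaK; apply: col_inj; rewrite ?iotaUV //.
        rewrite col_iota //; apply/eqP; rewrite eqn_leq lexv /= leqNgt.
        apply: contraL ltwx => ltxv; rewrite -leqNgt -(col_iota Ux).
        by apply: wmax; rewrite /P Fx iotaUV Ux col_iota.
      by rewrite colv ltw leqnn.
    have [eqx|_] := eqVneq x (iota v); first by rewrite eqx iotaVU Vv in Ux.
    have [Vx|Vx] := boolP (x \in V); last by rewrite !GN // andNb.
    rewrite !GV //; case: (x \in F1) => //=.
    rewrite -ltnNge; apply/negbTE; rewrite negb_and -leqNgt -ltnNge.
    by case: (leqP (col w) (col x)) => //= /ltn_trans->.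
  have iotavN (F2 : {set T}) w : v \notin F2 -> iota v \notin G F2 w.
    by move=> Fv2; rewrite GU ?iotaVU // iotaK (negPf Fv2).
  have vN (F2 : {set T}) w : v \notin F2 -> v \notin G F2 w.
    by move=> Fv2; rewrite GV // (negPf Fv2).
  case/orP=> [ltrk|/andP[/eqP eqrk ltc]]; last first.
    have eqF := injS _ _ SF' SF eqrk; rewrite eqF in Fv' *.
    have [w [Fw Vw le lt] Gdiff] := step _ Fv' Vv' ltc.
    exists (iota v), (G F1 w); split=> //; first exact: S'G.
      by rewrite rkG // rk_lt eqxx lt orbT.
    by rewrite GU ?iotaVU // iotaK colv Fv -ltnNge.
  have [x [F'' [SF'' ltF'' Fdiff xF']]] := exS _ _ SF SF' ltrk.
  have FF'' y : y != x -> y \in F1 -> y \in F''.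
    by move/setP/(_ y): Fdiff; rewrite !inE; case: eqP => // _; case: (y \in F1); case: (y \in F'').
  have Fx : x \in F1 by have := set11 x; rewrite -Fdiff inE => /andP[].
  have F''x : x \notin F'' by have := set11 x; rewrite -Fdiff inE => /andP[].
  (* If the exchange removes [v], then [F''] cannot step down at [v]; keep [F1] and move the step
     left instead. There is room: [v0] lies in [F'] and [v] does not. *)
  have [eqxv|nexv] := eqVneq x v.
    rewrite eqxv in xF'.
    have lt0 : col v0 < col v.
      rewrite ltn_neqAle minv0 // andbT; apply: contraNneq xF' => /(col_inj Vv0 Vv) <-.
      exact: Sv0.
    have [w [Fw Vw le lt] Gdiff] := step _ (Sv0 _ SF) Vv0 lt0.
    exists (iota v), (G F1 w); split=> //; [exact: S'G| |exact: iotavN].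
    by rewrite rkG // rk_lt eqxx lt orbT.
  have F''v : v \in F'' by rewrite FF'' // eq_sym.
  (* [y] is the copy of [x] present in [G F1 v]; since [x] is not [v], there is just one. *)
  pose y := if (x \in V) && (col x < col v) then iota x else x.
  exists y, (G F'' v); split=> //; first exact: S'G.
  + by rewrite rkG // rk_lt ltF''.
  + have Ux := SU _ _ SF Fx; apply/setP=> z; rewrite in_setD in_set1 !GE.
    have -> : ~~ ((mu z \in F'') && cond v z) && ((mu z \in F1) && cond v z) =
              (mu z == x) && cond v z.
      case: (cond v z); rewrite ?andbF // !andbT -in_setD Fdiff.
      exact: in_set1.
    apply/andP/eqP=> [[/eqP muz]|->].
      rewrite /y -muz /mu /cond; case: ifP => Uz.
        rewrite iotaUV Uz col_iota // iotaK leq_eqVlt => /predU1P[eqc|->//].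
        case/eqP: nexv; rewrite -muz /mu Uz.
        by apply: col_inj; rewrite ?iotaUV // col_iota.
      by case: (boolP (z \in V)) => //= _; rewrite ltnNge => ->.
    rewrite /y; case: ifP => [/andP[Vx lt]|]; rewrite /mu /cond.
      by rewrite iotaVU Vx iotaK -col_iota ?iotaVU // iotaK ltnW.
    by rewrite (negPf Ux); case: (x \in V) => //= /negbT; rewrite -leqNgt.
  + rewrite GE negb_and; apply/orP; left; rewrite /y; case: ifP => [/andP[Vx _]|_].
      by rewrite /mu iotaVU Vx iotaK.
    by rewrite /mu (negPf (SU _ _ SF Fx)).
Qed.
End RowDoubling.

(** * Complexes of cells with bounded chains *)

Section Chains.
Variable n : nat.
Local Notation T := (Xplus n).
Implicit Types (p q x : T) (s : seq T) (Z : {set T}) (cap : T -> nat).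
Implicit Types (g h : nat -> nat).

Definition crow p : nat := (val p).1.
Definition ccol p : nat := (val p).2.

Lemma row_lt_col p : crow p < ccol p.
Proof. exact: (valP p). Qed.

Lemma col_ltn p : ccol p < n.
Proof. exact: ltn_ord. Qed.

Lemma cell_inj p q : crow p = crow q -> ccol p = ccol q -> p = q.
Proof.
case: p q => -[a b] lt_ab [[c d] lt_cd]; rewrite /crow /ccol /= => ac bd.
by apply/val_inj; rewrite /= (val_inj ac) (val_inj bd).
Qed.

Lemma cellP i j : i < j -> j < n -> exists2 p, crow p = i & ccol p = j.
Proof.
move=> lt_ij lt_jn; pose e := (Ordinal (ltn_trans lt_ij lt_jn), Ordinal lt_jn).
by exists (Sub e lt_ij); rewrite /crow /ccol SubK.
Qed.

Definition nest p q := (crow p < crow q) && (ccol q < ccol p).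

Lemma nest_trans : transitive nest.
Proof.
move=> q p x /andP[r1 c1] /andP[r2 c2].
by rewrite /nest (ltn_trans r1 r2) (ltn_trans c2 c1).
Qed.

Lemma nest_irr : irreflexive nest.
Proof. by move=> p; rewrite /nest ltnn. Qed.

Lemma path_nest p s : path nest p s -> crow p + (size s).*2 < ccol p.
Proof.
elim: s p => [|q s IHs] p /=; first by have := row_lt_col p; lia.
case/andP=> /andP[lt1 lt2] /IHs; rewrite doubleS; move: (size s) => k; lia.
Qed.

(** [s] is only the tail, so the strict inequality says that a chain with outermost cell [p] has at
    most [cap p] cells. *)
Definition chain_le cap Z : Prop :=
  forall p s, path nest p s -> {subset p :: s <= Z} -> size s < cap p.

Lemma eq_chain_le cap cap' Z :
  {in Z, cap =1 cap'} -> chain_le cap Z -> chain_le cap' Z.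
Proof.
by move=> eqc h p s ps sZ; have := h p s ps sZ; rewrite eqc // sZ ?mem_head.
Qed.

(** A chain inside [x] can be extended by [x], so in the link it has at most [(cap x).-1] cells. *)
Definition link_cap cap x p :=
  if nest x p then minn (cap p) (cap x).-1 else cap p.

(** No cell of [Z] contains [x], so [x] can only head a chain, and bounding that chain means
    bounding its tail. *)
Lemma chain_le_link cap Z x :
    x \in Z -> {in Z, forall q, ~~ nest q x} ->
  chain_le cap Z <-> 0 < cap x /\ chain_le (link_cap cap x) (Z :\ x).
Proof.
move=> Zx outx; split=> [h|[cx h] p s ps sZ].
  split; first by apply: (h x [::]) => // q /[!inE]/eqP->.
  move=> p s ps sZ; rewrite /link_cap.
  have sZ' : {subset p :: s <= Z} by move=> q /sZ /setD1P[].
  have := h p s ps sZ'; case: ifP => // xp lts.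
  rewrite leq_min lts -ltnS (leq_trans (h x (p :: s) _ _)) ?leqSpred //=.
    by rewrite xp.
  by move=> q /predU1P[->|/sZ'].
have Zp : p \in Z by rewrite sZ ?mem_head.
have xs : x \notin s.
  apply/negP=> /(allP (order_path_min nest_trans ps)).
  exact/negP/outx.
have [eqx|nex] := eqVneq p x; last first.
  have : size s < link_cap cap x p.
    apply: h => // q qs; apply/setD1P; split; last exact: sZ.
    by move: qs; rewrite inE => /predU1P[->//|]; apply: contraTneq => ->.
  by rewrite /link_cap; case: ifP => // _; rewrite leq_min => /andP[].
case: s => [|q s] in ps sZ xs *; first by rewrite eqx.
have /andP[pq qs] := ps; have /= : size s < link_cap cap x q.
  apply: h => // z zs; apply/setD1P; split; last by rewrite sZ // inE zs orbT.
  by apply: contraNneq xs => <-.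
by rewrite /link_cap -eqx pq leq_min => /andP[_]; rewrite eqx; case: (cap x).
Qed.

(* Cells are removed row by row from the top and from right to left in each row;
   remaining i j is the set of cells left when the removal has reached column j of
   crow i, and chains starting at column y are bounded by g y in row i and by h y
   in the rows below. *)
Definition remaining i j : {set T} :=
  [set p | (i < crow p) || (crow p == i) && (ccol p <= j)].

Definition row_cap i g h p := if crow p == i then g (ccol p) else h (ccol p).

Definition stage i j g h Z : Prop :=
  Z \subset remaining i j /\ chain_le (row_cap i g h) Z.

(** The tail of a chain headed in column [y.+1] is already bounded by [g y], so a jump by more than
    one would not be attained. *)
Definition slow g := forall y, g y <= g y.+1 <= (g y).+1.

Lemma slow_leq g y z : slow g -> y <= z -> g y <= g z.
Proof.
move=> slowg /subnK <-; elim: (z - y) => //= k; rewrite addSn.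
by move=> /leq_trans-> //; case/andP: (slowg (k + y)).
Qed.

(* The length of the longest chain in rows >= i and columns <= y. *)
Definition depth i y := (y.+1 - i)./2.

(** The size of a facet. The sum follows the border of the region, along row [i] and then down the
    last column, and adds the length of the longest chain allowed in columns up to [y], respectively
    in rows from [k] on. If [g] bounds nothing, the total is the number of cells. *)
Definition corank i g :=
  \sum_(i <= y < n) minn (g y) (depth i y) +
  \sum_(i.+1 <= k < n) minn (g n.-1) (depth k n.-1).

(** Counts the cells of row [i] that act as cone points: even the longest chain allowed strictly
    inside such a cell, in rows below and columns up to [y.-1], may be extended by it. *)
Definition free_cells i j g h :=
  \sum_(i.+1 <= y < j.+1) (minn (h y.-1) (depth i.+1 y.-1) < g y).

(** With D = [depth i.+1 y], one has [depth i y.+1] = D + 1, and slowness gives min(g(y+1), D+1) =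
    min(g y, D) + [min(g y, D) < g(y+1)]; the bracket is the indicator of a free cell. Summing over
    columns shifts the row by one. *)
Lemma corankE i g : i < n -> slow g ->
  corank i g = free_cells i n.-1 g g + corank i.+1 g.
Proof.
move=> lt_in slowg; rewrite /corank /free_cells prednK; last by case: n lt_in.
have depth0 k : depth k k = 0 by rewrite /depth subSnn.
(* The extra summand on the left is the first term of the row sum of [corank i g], truncated at
   column [i + k]. *)
suff E k : \sum_(i <= y < i + k.+1) minn (g y) (depth i y) +
             minn (g (i + k)) (depth i.+1 (i + k)) =
           \sum_(i.+1 <= y < i + k.+1) (minn (g y.-1) (depth i.+1 y.-1) < g y) +
             \sum_(i.+1 <= y < i + k.+1) minn (g y) (depth i.+1 y).
  have := E (n - i).-1; rewrite prednK ?subn_gt0 // subnKC ?(ltnW lt_in) //.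
  have -> : i + (n - i).-1 = n.-1 by lia.
  move=> {}E; have [lt|ge] := ltnP i.+1 n.
    by rewrite (big_ltn lt) addnA E !addnA.
  have eqn : n.-1 = i by lia.
  move: E; rewrite eqn [depth i.+1 i]/depth subnn minn0 addn0 => ->.
  by rewrite !(@big_geq _ _ _ i.+1 n) // !(@big_geq _ _ _ i.+2 n) // ltnW.
elim: k => [|k IHk].
  by rewrite addn0 addn1 big_nat1 !big_geq // depth0 minn0 /depth subnn minn0.
rewrite !addnS big_nat_recr /=; last by lia.
rewrite [in RHS]big_nat_recr /=; last by lia.
rewrite [X in _ = _ + X]big_nat_recr /=; last by lia.
rewrite !addnS in IHk.
have -> : depth i (i + k).+1 = (depth i.+1 (i + k)).+1.
  by rewrite /depth; lia.
have /andP[] := slowg (i + k); lia.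
Qed.

(** Where truncation lowers the summand of a column y from [k] to [k.-1], the cell in column y + 1
    becomes free, which compensates the loss. Only the loss in column [j.-1] is uncompensated: the
    cell it would free is the one being removed, in column [j]. *)
Lemma free_cells_drop i j k g h :
    slow g -> i < j -> (forall y, y < j -> h y = g y) ->
    g j.-1 = k -> 0 < k <= depth i.+1 j.-1 ->
  free_cells i j.-1 g h + \sum_(i.+1 <= y < j) minn (h y) (depth i.+1 y) =
  (free_cells i j.-1 g (fun y => minn (h y) k.-1) +
   \sum_(i.+1 <= y < j) minn (minn (h y) k.-1) (depth i.+1 y)).+1.
Proof.
move=> slowg lt_ij eqh gj /andP[k_gt0 le_k].
have le_gk y : y < j -> g y <= k.
  by move=> lt_yj; rewrite -gj slow_leq //; lia.
have E N : i + N < j ->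
    free_cells i (i + N) g h + \sum_(i.+1 <= y < i + N) minn (h y) (depth i.+1 y) =
    free_cells i (i + N) g (fun y => minn (h y) k.-1) +
    \sum_(i.+1 <= y < i + N) minn (minn (h y) k.-1) (depth i.+1 y).
  rewrite /free_cells; elim: N => [|[|N] IHN] ltj.
  - by rewrite addn0 !big_geq.
  - rewrite addn1 !big_nat1 !big_geq // /= /depth subnn !minn0.
    by rewrite !addn0.
  rewrite !addnS in ltj IHN *; move: (IHN (ltnW ltj)) => {}IHN.
  rewrite [X in X + _ = _](@big_nat_recr _ _ _ (i + N).+2) /=; last by lia.
  rewrite [X in _ + X = _](@big_nat_recr _ _ _ (i + N).+1) /=; last by lia.
  rewrite [X in _ = X + _](@big_nat_recr _ _ _ (i + N).+2) /=; last by lia.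
  rewrite [X in _ = _ + X](@big_nat_recr _ _ _ (i + N).+1) /=; last by lia.
  have := le_gk _ ltj; have := le_gk _ (ltnW ltj).
  have /andP[] := slowg (i + N).+1; rewrite eqh ?(ltnW ltj) //; lia.
have lt_i : i.+1 < j by move: le_k; rewrite /depth; lia.
have := E (j.-1 - i); have -> : i + (j.-1 - i) = j.-1 by lia.
move=> /(_ ltac:(lia)) {}E.
have ej : j = j.-1.+1 by lia.
have ltj : j.-1 < j by lia.
rewrite [in X in _ + X = _]ej [in X in _ = (_ + X).+1]ej.
rewrite !big_nat_recr /=; try lia.
rewrite !eqh // gj; lia.
Qed.

Lemma corank_drop i j k g h :
    slow g -> slow h -> i < j < n -> (forall y, y < j -> h y = g y) ->
    g j.-1 = k -> 0 < k <= depth i.+1 j.-1 ->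
    let h' y := if y < j then minn (h y) k.-1 else h y in
  free_cells i j.-1 g h + corank i.+1 h =
  (free_cells i j.-1 g h' + corank i.+1 h').+1.
Proof.
move=> slowg slowh /andP[lt_ij lt_jn] eqh gj le_k h'.
have := free_cells_drop slowg lt_ij eqh gj le_k.
have -> : free_cells i j.-1 g h' = free_cells i j.-1 g (fun y => minn (h y) k.-1).
  by apply: eq_big_nat => y ?; rewrite /h' ifT //; lia.
rewrite /corank /h' [n.-1 < j]ltnNge.
have -> /= : j <= n.-1 by lia.
rewrite !(@big_cat_nat _ _ _ j i.+1 n) //=; try lia.
have -> : \sum_(i.+1 <= y < j) minn (if y < j then minn (h y) k.-1 else h y) (depth i.+1 y) =
    \sum_(i.+1 <= y < j) minn (minn (h y) k.-1) (depth i.+1 y).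
  by apply: eq_big_nat => y /andP[_ ->].
have -> : \sum_(j <= y < n) minn (if y < j then minn (h y) k.-1 else h y) (depth i.+1 y) =
    \sum_(j <= y < n) minn (h y) (depth i.+1 y).
  by apply: eq_big_nat => y /andP[le _]; rewrite ltnNge le.
lia.
Qed.

Lemma remaining_row i : remaining i i = remaining i.+1 n.-1.
Proof.
apply/setP=> p; rewrite !inE; have := row_lt_col p; have := col_ltn p.
by move: (crow p) (ccol p) => r c; case: eqP => [->|]; lia.
Qed.

Lemma remainingS i j x : crow x = i -> ccol x = j.+1 ->
  remaining i j.+1 = x |: remaining i j.
Proof.
move=> rx cx; apply/setP=> p; rewrite !inE.
have -> : (p == x) = (crow p == i) && (ccol p == j.+1).
  apply/eqP/andP=> [->|[/eqP rp /eqP cp]]; first by rewrite rx cx !eqxx.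
  by apply: cell_inj; rewrite ?rx ?cx.
by case: ltngtP => //= _; rewrite leq_eqVlt.
Qed.

(* In the last case of a step the cell x is not a cone point; then the link loses
   exactly one free cell (corank_drop), which is what keeps the complex pure. *)
Lemma stage_pure_shellable i j g h m :
    slow g -> slow h -> i <= j < n -> (forall y, y <= j -> h y = minn (g y) m) ->
    (forall h, slow h ->
       pure_shellable (stage i.+1 n.-1 h h) (corank i.+1 h)) ->
  pure_shellable (stage i j g h) (free_cells i j g h + corank i.+1 h).
Proof.
move=> slowg slowh /andP[le_ij lt_jn] hE next; move: lt_jn hE.
rewrite -(subnKC le_ij); elim: (j - i) h m slowh => {j le_ij} [|k IHk] h m slowh.
  rewrite addn0 => lt_in _; rewrite /free_cells big_geq // add0n.
  apply: eq_pure_shellable (next h slowh) => Z.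
  have capE p : p \in remaining i.+1 n.-1 -> row_cap i g h p = row_cap i.+1 h h p.
    rewrite inE /row_cap => Rp; case: ifP => [/eqP rp|_]; last by case: ifP.
    by rewrite rp ltn_eqF // ltnNge leqnSn in Rp.
  rewrite /stage remaining_row; split=> -[sZ leZ]; split=> //;
    by apply: eq_chain_le leZ => p /(subsetP sZ) /capE.
rewrite addnS; set j := i + k in IHk *; move=> lt_jn hE.
have [x rx cx] : exists2 x, crow x = i & ccol x = j.+1.
  by apply: cellP => //; rewrite /j; lia.
have xR : x \notin remaining i j by rewrite inE rx cx !ltnn eqxx.
have RS := remainingS rx cx.
have outx Z : Z \subset x |: remaining i j -> {in Z, forall q, ~~ nest q x}.
  move=> /subsetP sZ q /sZ; rewrite in_setU1 inE /nest rx => /predU1P[->|].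
    by rewrite rx ltnn.
  by case/orP=> [lt|/andP[/eqP-> _]]; rewrite ?ltnn // ltnNge ltnW.
have IH0 := IHk h m slowh (ltnW lt_jn) (fun y le => hE y (leqW le)).
have stage0 Z : stage i j g h Z -> x \notin Z.
  by case=> sZ _; apply: contra xR; apply: subsetP.
have dropx Z : x \notin Z -> stage i j.+1 g h Z <-> stage i j g h Z.
  move=> xZ; rewrite /stage RS; split=> -[sZ leZ]; split=> //.
    by rewrite -(setU1K xR) subsetD1 sZ.
  exact: subset_trans sZ (subsetUr _ _).
have capx : row_cap i g h x = g j.+1 by rewrite /row_cap rx eqxx cx.
have freeS : free_cells i j.+1 g h =
    free_cells i j g h + (minn (h j) (depth i.+1 j) < g j.+1).
  by rewrite /free_cells big_nat_recr //= ltnS /j leq_addr.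
(* The bound for the link of [x]. The cells left in row [i] are not nested in [x], so [g] is
   unchanged. *)
pose h' y := if y < j.+1 then minn (h y) (g j.+1).-1 else h y.
have capx' Z : Z \subset remaining i j ->
    {in Z, link_cap (row_cap i g h) x =1 row_cap i g h'}.
  move=> /subsetP sZ p /sZ; rewrite inE /link_cap /row_cap /nest rx cx eqxx /h'.
  by case: ltngtP.
have linkx Z : x \in Z -> stage i j.+1 g h Z <->
    0 < g j.+1 /\ stage i j g h' (Z :\ x).
  move=> Zx; rewrite /stage RS -subDset; split.
    move=> [sZ]; rewrite subDset in sZ; rewrite (chain_le_link _ Zx (outx _ sZ)).
    rewrite -subDset in sZ; rewrite capx => -[gj leZ]; do 2?[split=> //].
    by move: leZ; apply: eq_chain_le; apply: capx'.
  move=> [gj [sZ leZ]]; split=> //.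
  rewrite (chain_le_link _ Zx); last by apply: outx; rewrite -subDset.
  by rewrite capx; split=> //; apply: eq_chain_le leZ => p pZ; rewrite (capx' _ sZ).
have h'h Z : stage i j g h' Z -> stage i j g h Z.
  case=> sZ leZ; split=> // p s ps /(leZ _ _ ps) /leq_trans; apply.
  by rewrite /row_cap /h'; case: eqP => // _; case: ifP => // _; rewrite geq_minl.
rewrite freeS; have [free|nfree] := ltnP.
  (* [x] is free: every allowed chain inside it is already short enough, by [h j] or by depth, so
     link and deletion agree. *)
  rewrite addn1 addSn; apply: (pure_shellable_cone stage0) IH0 => Z.
  have hh' Z' : stage i j g h Z' -> stage i j g h' Z'.
    move=> [sZ leZ]; split=> // p s ps sZ'; have := leZ p s ps sZ'.
    have := subsetP sZ p (sZ' p (mem_head _ _)); rewrite inE /row_cap.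
    case: ltngtP => //= lt_ip _ lt_sh; rewrite /h'; case: ifP => // lt_pj.
    rewrite leq_min lt_sh /=.
    have := path_nest ps; have := @slow_leq h (ccol p) j slowh lt_pj.
    move: free lt_sh lt_ip lt_pj; rewrite /depth.
    by move: (size s) (crow p) (ccol p) (h j) => a b c d; lia.
  have gj : 0 < g j.+1 by apply: leq_ltn_trans free.
  have [Zx|xZ] := boolP (x \in Z).
    by rewrite linkx //; split=> [[_ /h'h]|/hh'].
  rewrite dropx //; suff -> : Z :\ x = Z by [].
  by apply/setDidPl; rewrite disjoint_sym disjoints1.
rewrite addn0; have [g0|gj] := posnP (g j.+1).
  apply: eq_pure_shellable IH0 => Z; have [Zx|xZ] := boolP (x \in Z).
    by rewrite linkx // g0; split=> [/stage0|[]//]; rewrite Zx.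
  by rewrite dropx.
have /andP[g1 g2] := slowg j.
have hj : h j <= g j by rewrite hE // geq_minl.
(* As [x] is not free, [g j.+1 <= h j <= g j]: so [g] is flat at [j], and the truncation by [m] has
   no effect on [h] up to there. *)
have gjk : g j = g j.+1.
  by move: nfree; rewrite leq_min => /andP[]; lia.
have le_m : g j.+1 <= m.
  by move: nfree; rewrite leq_min => /andP[]; rewrite hE // leq_min => /andP[].
have hg y : y < j.+1 -> h y = g y.
  move=> lt_yj; rewrite hE ?(ltnW lt_yj) //; apply/minn_idPl.
  by apply: leq_trans le_m; rewrite slow_leq // ltnW.
have slowh' : slow h'.
  move=> y; rewrite /h' !ltnS; have [lt_yj|lt_jy|->] := ltngtP y j.
  - by have := slowh y; lia.
  - exact: slowh.
  by rewrite (hg j) // gjk (hE j.+1) // (minn_idPl le_m); lia.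
have h'E y : y <= j -> h' y = minn (g y) (minn m (g j.+1).-1).
  by move=> le_yj; rewrite /h' ltnS le_yj hE ?leqW // minnA.
have dep : 0 < g j.+1 <= depth i.+1 j by move: nfree; rewrite gj leq_min => /andP[].
have lt_ij : i < j.+1 < n by rewrite lt_jn ltnS leq_addr.
have dropE := corank_drop slowg slowh lt_ij hg gjk dep.
have IH1 := IHk h' _ slowh' (ltnW lt_jn) h'E.
move: IH0; rewrite dropE => IH0; apply: (pure_shellable_shed stage0 h'h) IH0 IH1.
  exact: dropx.
by move=> Z Zx; rewrite linkx //; split=> [[]|].
Qed.

Lemma rows_pure_shellable i g : slow g ->
  pure_shellable (stage i n.-1 g g) (corank i g).
Proof.
have [k] := ubnP (n - i); elim: k i g => // k IHk i g ltk slowg.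
have [le_ni|lt_in] := leqP n i.
  rewrite /corank !big_geq ?leqW //; apply: eq_pure_shellable (pure_shellable_point _).
  move=> Z; have R0 : remaining i n.-1 = set0.
    apply/setP=> p; rewrite !inE; have := row_lt_col p; have := col_ltn p.
    by move: (crow p) (ccol p); lia.
  rewrite /stage R0 subset0; split=> [->|[/eqP//]]; split=> // p s _ sZ.
  by have := sZ p (mem_head _ _); rewrite inE.
rewrite corankE //; apply: (@stage_pure_shellable i _ g g (g n)) => //.
- by lia.
- by move=> y le_yn; apply/esym/minn_idPl; apply: slow_leq => //; lia.
by move=> h; apply: IHk; lia.
Qed.

End Chains.

Arguments nest {n} p q.
Arguments nest_trans {n}.

(** * The ladder complex attached to consecutive entries *)

Section CombinatorialComplex.
Variables (n s c d : nat).
Local Notation T := (Xplus n).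
Implicit Types (p q x : T) (Z : {set T}).

(** The columns of a chain are at most that of its outermost cell, so both chain conditions become
    one bound by that column. Here [s], [c], [d] stand for half the length, the second and the last
    entry of the index. *)
Definition step_cap y := if y < d then s.-1 else s.

Definition ladder_complex m Z : Prop :=
  [/\ {in Z, forall p, m <= crow p /\ c <= ccol p},
      {in Z &, forall p q, nest p q -> c <= crow q}
    & chain_le (fun p => step_cap (ccol p)) Z].

Hypotheses (s_gt0 : 0 < s) (c_gt0 : 0 < c) (c_lt_n : c < n).
Hypothesis s1 : s = 1 -> d <= c.

Lemma slow_step_cap : slow step_cap.
Proof. by move=> y; rewrite /step_cap; case: (ltnP y d); case: (ltnP y.+1 d); lia. Qed.

Lemma ladder_complex_stage Z :
  ladder_complex c.-1 Z <-> stage c.-1 n.-1 step_cap step_cap Z.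
Proof.
have capE p : row_cap c.-1 step_cap step_cap p = step_cap (ccol p).
  by rewrite /row_cap; case: ifP.
have RE p : (p \in remaining n c.-1 n.-1) = (c.-1 <= crow p).
  by rewrite inE; have := col_ltn p; have := row_lt_col p; lia.
split=> [[Zp _ leZ]|[/subsetP sZ leZ]].
  split; first by apply/subsetP=> p /Zp[]; rewrite RE.
  by apply: eq_chain_le leZ => p _; rewrite capE.
have rowZ p : p \in Z -> c.-1 <= crow p by move/sZ; rewrite RE.
split=> [p Zp|p q Zp Zq /andP[lt_pq _]|].
- by have := rowZ p Zp; have := row_lt_col p; split=> //; lia.
- by have := rowZ p Zp; lia.
by apply: eq_chain_le leZ => p _; rewrite capE.
Qed.

Definition move_row r p : T :=
  odflt p [pick q | (crow q == r) && (ccol q == ccol p)].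

Lemma move_rowP r p : r < ccol p ->
  crow (move_row r p) = r /\ ccol (move_row r p) = ccol p.
Proof.
move=> lt_rp; have [q rq cq] := cellP lt_rp (col_ltn p).
rewrite /move_row; case: pickP => [q' /andP[/eqP ? /eqP ?] //|/(_ q)].
by rewrite rq cq !eqxx.
Qed.

Lemma path_nest_head p q t :
  crow q <= crow p -> ccol q = ccol p -> path nest p t -> path nest q t.
Proof.
case: t => //= x t le_qp eq_qp /andP[/andP[lt1 lt2] ->].
by rewrite /nest (leq_ltn_trans le_qp) // eq_qp lt2.
Qed.

(** [x] lies in the first row and the first column allowed, hence is comparable with no other
    cell. *)
Lemma ladder_complex_cone m x Z : crow x = m -> ccol x = c ->
  ladder_complex m Z -> ladder_complex m (x |: Z).
Proof.
move=> rx cx [Zp Zc Zle]; have xout q : q \in Z -> ~~ nest q x /\ ~~ nest x q.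
  move=> /Zp[rq cq]; rewrite /nest rx cx; split; rewrite negb_and -!leqNgt ?rq //.
  by rewrite cq orbT.
have nestx p q : p \in x |: Z -> q \in x |: Z -> nest p q -> p \in Z /\ q \in Z.
  case/setU1P=> [->|Z1] /setU1P[->|Z2] //; rewrite ?nest_irr //.
    by rewrite (negPf (xout q Z2).2).
  by rewrite (negPf (xout p Z1).1).
split=> [p /setU1P[->|/Zp//]|p q Zp1 Zq1 npq|p t pt sZ].
- by rewrite rx cx.
- by have [] := nestx p q Zp1 Zq1 npq => *; apply: Zc npq.
have Zp1 : p \in x |: Z by rewrite sZ ?mem_head.
case: t => [|q t] in pt sZ *; last first.
  apply: Zle => // z zt; have nz : forall y, y \in q :: t -> y \in Z.
    move=> y yt; have npy := allP (order_path_min nest_trans pt) y yt.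
    by have [] := nestx p y Zp1 (sZ y _) npy; rewrite // inE yt orbT.
  move: zt; rewrite inE => /predU1P[->|/nz//].
  have := allP (order_path_min nest_trans pt) q (mem_head _ _).
  by move/nestx => -[] //; rewrite sZ // !inE eqxx orbT.
case/setU1P: Zp1 => [->|Zp1].
  (* The bound at [x] could vanish only for [s = 1], where [s1] excludes [c < d]. *)
  rewrite cx /step_cap /=; case: ifP => // lt_cd.
  by have := s1; lia.
by apply: Zle => // q; rewrite inE => /eqP->.
Qed.

(** Descent from [c.-1]. While [m.+1 < c], no cell of row [m.+1] may lie inside one of row [m],
    which is the monotonicity condition of row doubling. Cells inside a cell of row [m] then lie in
    rows from [c] on, so pushing the outer cell down to row [m.+1] preserves all nestings. *)
Lemma ladder_complex_pure_shellable m : m <= c.-1 ->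
  exists k, pure_shellable (ladder_complex m) k.
Proof.
move=> le_mc; rewrite -(subKn le_mc); elim: (c.-1 - m) => [|j [k IHj]].
  rewrite subn0; eexists; apply: eq_pure_shellable.
    by move=> Z; symmetry; apply: ladder_complex_stage.
  exact/rows_pure_shellable/slow_step_cap.
have [le_cj|lt_jc] := leqP c.-1 j.
  by exists k; have -> : c.-1 - j.+1 = c.-1 - j by lia.
have : (c.-1 - j.+1).+1 = c.-1 - j by lia.
have : c.-1 - j.+1 < c.-1 by lia.
move: (c.-1 - j.+1) (c.-1 - j) IHj => {le_mc lt_jc j}m m1 IHm lt_mc em; subst m1.
have lt_m1c : m.+1 < c by lia.
pose U := [set p : T | (crow p == m) && (c <= ccol p)].
pose V := [set p : T | (crow p == m.+1) && (c <= ccol p)].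
pose iota p := if c <= ccol p then
   if crow p == m then move_row m.+1 p else
   if crow p == m.+1 then move_row m p else p else p.
have iotaU p : p \in U -> crow (iota p) = m.+1 /\ ccol (iota p) = ccol p.
  rewrite inE /iota => /andP[/eqP-> le_cp]; rewrite le_cp eqxx.
  by apply: move_rowP; apply: leq_trans le_cp.
have iotaV p : p \in V -> crow (iota p) = m /\ ccol (iota p) = ccol p.
  rewrite inE /iota => /andP[/eqP-> le_cp]; rewrite le_cp eqxx gtn_eqF //.
  by apply: move_rowP; apply: leq_trans le_cp; apply: ltnW.
have iotaN p : p \notin U -> p \notin V -> iota p = p.
  by rewrite !inE /iota; case: (c <= ccol p); rewrite ?andbF // !andbT => /negPf-> /negPf->.
have UV p : p \in U -> iota p \in V.
  by move=> Up; have [r1 c1] := iotaU p Up; move: Up; rewrite !inE r1 c1 eqxx => /andP[].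
have VU p : p \in V -> iota p \in U.
  by move=> Vp; have [r1 c1] := iotaV p Vp; move: Vp; rewrite !inE r1 c1 eqxx => /andP[].
have disjUV p : p \in U -> p \notin V.
  by rewrite !inE => /andP[/eqP-> _]; rewrite ltn_eqF.
have iotaK : involutive iota.
  move=> p; have [Up|Up] := boolP (p \in U).
    have [r1 c1] := iotaU p Up; have [r2 c2] := iotaV _ (UV p Up).
    by apply: cell_inj; rewrite ?r2 ?c2 //; move: Up; rewrite inE => /andP[/eqP].
  have [Vp|Vp] := boolP (p \in V); last by rewrite !iotaN.
  have [r1 c1] := iotaV p Vp; have [r2 c2] := iotaU _ (VU p Vp).
  by apply: cell_inj; rewrite ?r2 ?c2 //; move: Vp; rewrite inE => /andP[/eqP].
have iotaUV p : (iota p \in V) = (p \in U).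
  by apply/idP/idP=> [/VU|/UV //]; rewrite iotaK.
have col_iota p : p \in U -> ccol (iota p) = ccol p by case/iotaU.
have col_inj : {in V &, injective (@ccol n)}.
  move=> p q /[!inE] /andP[/eqP rp _] /andP[/eqP rq _]; apply: cell_inj.
  by rewrite rp rq.
have [v0 rv0 cv0] := @cellP n m.+1 c lt_m1c c_lt_n.
pose mu p := if p \in U then iota p else p.
have muE p : ccol (mu p) = ccol p /\ (m <= crow p -> c <= ccol p ->
    crow (mu p) = maxn m.+1 (crow p)).
  rewrite /mu; case: ifP => [Up|]; last first.
    rewrite inE => /negbT Up; split=> // le_m le_c.
    by move: Up; rewrite le_c andbT => ne; apply/esym/maxn_idPr; rewrite ltn_neqAle eq_sym ne.
  have [r1 c1] := iotaU p Up; rewrite r1 c1; split=> // _ _.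
  by move: Up; rewrite inE => /andP[/eqP-> _]; rewrite (maxn_idPl _).
have muN p : m < crow p -> mu p = p.
  by move=> lt; rewrite /mu inE gtn_eqF.
exists k.+1; apply: (pure_shellable_row_doubling iotaK iotaUV disjUV col_iota col_inj
  (v0 := v0) (D := ladder_complex m.+1)) IHm.
- by move=> Z p [Zp _ _] /Zp[lt _]; rewrite inE gtn_eqF.
- by rewrite inE rv0 cv0 eqxx leqnn.
- by move=> p /[!inE] /andP[_]; rewrite cv0.
- by move=> Z; apply: ladder_complex_cone.
move=> Z; rewrite -/mu; split=> [[Zp Zc Zle]|[compat [Zp Zc Zle]]].
  have muZ q : q \in mu @: Z -> m.+1 < crow q -> q \in Z.
    case/imsetP=> p Zp1 ->; have [r1 c1] := Zp p Zp1.
    have [_ ->] // := muE p; rewrite leq_max ltnn /= => lt.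
    by rewrite muN // ltnW.
  have muZr p : p \in Z -> crow p <= crow (mu p).
    by move=> Zp1; have [r1 c1] := Zp p Zp1; have [_ ->] // := muE p; apply: leq_maxr.
  have muZm p : p \in Z -> m < crow (mu p).
    by move=> Zp1; have [r1 c1] := Zp p Zp1; have [_ ->] // := muE p; apply: leq_maxl.
  split.
    move=> p q; rewrite !in_setI !inE => /and3P[Zp1 /eqP rp _] /and3P[Zq1 /eqP rq _].
    rewrite leqNgt; apply/negP=> lt; have := Zc p q Zp1 Zq1.
    by rewrite /nest rp rq ltnSn lt => /(_ isT); rewrite leqNgt lt_m1c.
  split.
  - move=> _ /imsetP[p Zp1 ->]; rewrite muZm // (muE p).1.
    by have [] := Zp p Zp1.
  - move=> _ y /imsetP[p Zp1 ->] muy /andP[lt1 lt2].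
    have lty : m.+1 < crow y by apply: leq_ltn_trans lt1; apply: muZm.
    apply: (Zc p) => //; first exact: muZ.
    by rewrite /nest -(muE p).1 lt2 (leq_ltn_trans (muZr p Zp1)).
  - move=> y t yt sZ; have /imsetP[p Zp1 ey] := sZ y (mem_head _ _).
    have cy : ccol y = ccol p by rewrite ey (muE p).1.
    rewrite cy; apply: Zle.
      by apply: path_nest_head yt; rewrite // ey muZr.
    move=> q; rewrite inE => /predU1P[->//|qt].
    apply: muZ; first by rewrite sZ // inE qt orbT.
    have /andP[lt _] := allP (order_path_min nest_trans yt) q qt.
    by apply: leq_ltn_trans lt; rewrite ey muZm.
have Zm p : p \in Z -> m <= crow p /\ c <= ccol p.
  move=> Zp1; have [] := Zp (mu p) (imset_f _ Zp1); rewrite (muE p).1 => r1 ->.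
  split=> //; move: r1; rewrite /mu; case: ifP => [|_ /ltnW//].
  by rewrite inE => /andP[/eqP->].
have muZ p q : p \in Z -> q \in Z -> nest p q -> nest (mu p) q.
  move=> Zp1 Zq1 /andP[lt1 lt2]; have [r1 c1] := Zm p Zp1; have [r2 c2] := Zm q Zq1.
  rewrite /nest (muE p).1 lt2 (muE p).2 // gtn_max lt1 !andbT ltn_neqAle.
  rewrite (leq_ltn_trans r1 lt1) andbT; apply/eqP=> rq.
  have := compat p q; rewrite !inE Zp1 Zq1 -rq eqxx c1 c2 leqNgt lt2 /= => h.
  suff : false by []. 
  apply: h => //; rewrite andbT eqn_leq r1 andbT -ltnS.
  by rewrite rq.
split=> // [p q Zp1 Zq1 npq|p t pt sZ].
  have lt_mq : m < crow q.
    by have [r1 c1] := Zm p Zp1; have /andP[lt _] := npq; apply: leq_ltn_trans lt.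
  apply: (Zc (mu p)); rewrite ?imset_f //; last exact: muZ.
  by rewrite -(muN q lt_mq) imset_f.
rewrite -(muE p).1; have Zp1 : p \in Z by rewrite sZ ?mem_head.
have tZ q : q \in t -> q \in Z by move=> qt; rewrite sZ // inE qt orbT.
apply: Zle.
  case: t pt {sZ} tZ => //= q t /andP[npq ->] tZ; rewrite muZ //.
  by apply: tZ; rewrite mem_head.
move=> q; rewrite inE => /predU1P[->|qt]; first exact: imset_f.
have /andP[lt _] := allP (order_path_min nest_trans pt) q qt.
by rewrite -(muN q) ?imset_f ?tZ //; apply: leq_ltn_trans lt; case: (Zm p Zp1).
Qed.

End CombinatorialComplex.

(** * Initial ideals and antidiagonals *)

Import GRing.Theory.

Section MonomialIdeals.
Variables (K : fieldType) (m : nat).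
Implicit Types (ord : rel 'X_{1..m}) (f : {mpoly K[m]}) (u w : 'X_{1..m}).

Lemma ideal_gen_monomial (S : {mpoly K[m]} -> Prop) w :
    (forall f, S f -> exists u, f = 'X_[u]) ->
  ideal_gen S 'X_[w] <-> exists2 u, S 'X_[u] & (u <= w)%MM.
Proof.
move=> monS; split=> [[s sS eqw]|[u Su le_uw]]; last first.
  exists [:: ('X_[w - u], 'X_[u])%R] => [_ /[!inE] /eqP-> //|].
  by rewrite big_seq1 -mpolyXD submK.
have : w \in msupp ('X_[K, w]) by rewrite msuppX inE.
rewrite eqw => /msupp_sum_le /flattenP[_ /mapP[cg scg ->]].
have Scg := sS _ (mem_subseq (filter_subseq _ _) scg).
have [u eu] := monS _ Scg; rewrite eu (perm_mem (msuppMX _ _)).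
case/mapP=> u' _ ->; exists u; first by rewrite -eu.
exact: lem_addr.
Qed.

Lemma initial_monomial_exists ord f : term_order ord -> f != 0%R ->
  exists u, is_initial_monomial ord f u.
Proof.
case=> tot _ tr _ _; rewrite -msupp_eq0 /is_initial_monomial.
elim: (msupp f) => //= u s IHs _; have [->|/IHs[v [sv vmax]]] := eqVneq s [::].
  exists u; split=> [|v]; rewrite inE // => /eqP->.
  by have := tot u u; rewrite orbb.
have [uv|vu] := orP (tot u v).
  exists v; split=> [|x]; first by rewrite inE sv orbT.
  by rewrite inE => /predU1P[->|/vmax].
exists u; split=> [|x]; first by rewrite mem_head.
rewrite inE => /predU1P[->|/vmax xv]; first by have := tot u u; rewrite orbb.
exact: tr vu.
Qed.

Lemma ideal_gen_mem (S : {mpoly K[m]} -> Prop) f : S f -> ideal_gen S f.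
Proof.
move=> Sf; exists [:: (1, f)%R] => [_ /[!inE] /eqP-> //|].
by rewrite big_seq1 mul1r.
Qed.

Lemma ideal_genD (S : {mpoly K[m]} -> Prop) f g :
  ideal_gen S f -> ideal_gen S g -> ideal_gen S (f + g)%R.
Proof.
move=> [s sS ->] [t tS ->]; exists (s ++ t); last by rewrite big_cat.
by move=> cg; rewrite mem_cat => /orP[/sS|/tS].
Qed.

Lemma ideal_genM (S : {mpoly K[m]} -> Prop) c f :
  ideal_gen S f -> ideal_gen S (c * f)%R.
Proof.
move=> [s sS ->]; exists [seq (c * cg.1, cg.2)%R | cg <- s].
  by move=> _ /mapP[cg /sS Scg ->].
by rewrite big_map mulr_sumr; apply: eq_bigr => cg _; rewrite mulrA.
Qed.

Lemma ideal_genB (S : {mpoly K[m]} -> Prop) f g :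
  ideal_gen S f -> ideal_gen S g -> ideal_gen S (f - g)%R.
Proof.
by move=> If Ig; apply: ideal_genD => //; rewrite -mulN1r; apply: ideal_genM.
Qed.

End MonomialIdeals.

(** * Index sequences and antidiagonal monomials *)

Section PfaffianEntries.
Variable n : nat.
Implicit Types (a b : pf_index n) (e : Xplus n) (u : 'X_{1..#|Xplus n|}).

(* Junk value 0 beyond the last entry. *)
Definition ent b k : nat := nth 0 [seq nat_of_ord i | i <- pf_seq b] k.

Lemma ent_tnth b (i : 'I_((pf_half b).*2)) : tnth (pf_seq b) i = ent b i :> nat.
Proof.
rewrite /ent (nth_map (tnth (pf_seq b) i)) ?size_tuple //.
by rewrite -tnth_nth.
Qed.

Lemma ent_lt b k l : k < l < (pf_half b).*2 -> ent b k < ent b l.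
Proof.
move=> /andP[lt_kl lt_l]; have lt_k := ltn_trans lt_kl lt_l.
have := @pf_seq_incr n b (Ordinal lt_k) (Ordinal lt_l) lt_kl.
by rewrite !ent_tnth.
Qed.

Lemma ent_ltn b k : k < (pf_half b).*2 -> ent b k < n.
Proof. by move=> lt_k; rewrite -(ent_tnth (Ordinal lt_k)). Qed.

Lemma ent_le_add b k l : k <= l < (pf_half b).*2 -> ent b k + (l - k) <= ent b l.
Proof.
move=> /andP[/subnKC <-]; elim: (l - k) => [|j IHj]; first by rewrite !addn0 subnn addn0.
rewrite addnS => lt_j; have := IHj (ltnW lt_j); have := @ent_lt b (k + j) (k + j).+1.
by rewrite ltnSn lt_j => /(_ isT); lia.
Qed.

Lemma pf_index_exists t (h : nat -> nat) : 0 < t ->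
    (forall k l, k < l < t.*2 -> h k < h l) -> (forall k, k < t.*2 -> h k < n) ->
  exists b, pf_half b = t /\ forall k, k < t.*2 -> ent b k = h k.
Proof.
move=> t_gt0 incr lt_hn; pose f (i : 'I_(t.*2)) := Ordinal (lt_hn i (ltn_ord i)).
have incrf (i j : 'I_(t.*2)) : i < j ->
    tnth [tuple f i | i < t.*2] i < tnth [tuple f i | i < t.*2] j.
  by move=> lt_ij; rewrite !tnth_mktuple /= incr // lt_ij /=.
exists (PfIndex t_gt0 incrf); split=> // k lt_k.
by rewrite -(@ent_tnth (PfIndex t_gt0 incrf) (Ordinal lt_k)) /= tnth_mktuple.
Qed.

Lemma pf_leP a b : pf_le a b <->
  pf_half b <= pf_half a /\ forall k, k < (pf_half b).*2 -> ent a k <= ent b k.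
Proof.
split=> -[le_ba le_ent]; split=> //; last first.
  by move=> i j eij; rewrite !ent_tnth eij; apply: le_ent.
move=> k lt_kb; have lt_ka : k < (pf_half a).*2 by rewrite (leq_trans lt_kb) ?leq_double.
by have := le_ent (Ordinal lt_ka) (Ordinal lt_kb) erefl; rewrite !ent_tnth.
Qed.

Lemma not_pf_leP a b : ~ pf_le a b <->
  pf_half a < pf_half b \/ exists2 k, k < (pf_half b).*2 & ent b k < ent a k.
Proof.
split=> [nle|gap /pf_leP[le1 le2]]; last first.
  by case: gap => [|[k /le2]]; rewrite ltnNge ?le1 // => ->.
have [lt|le] := ltnP (pf_half a) (pf_half b); [by left|right].
have [k lt_k|all_le] := pickP [pred k : 'I_((pf_half b).*2) | ent b k < ent a k].
  by exists k.
case: nle; apply/pf_leP; split=> // k lt_k.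
by have := all_le (Ordinal lt_k) => /= /negbT; rewrite -leqNgt.
Qed.

(** Indices are plain numbers so that entries can be replaced by composing functions; a pair that is
    no cell gives the trivial monomial. *)
Definition cell_mon (i j : nat) : 'X_{1..#|Xplus n|} :=
  if [pick e : Xplus n | (crow e == i) && (ccol e == j)] is Some e
  then U_(enum_rank e)%MM else 0%MM.

Lemma cell_monE e : cell_mon (crow e) (ccol e) = U_(enum_rank e)%MM.
Proof.
rewrite /cell_mon; case: pickP => [e' /andP[/eqP r /eqP c]|/(_ e)].
  by rewrite (cell_inj r c).
by rewrite !eqxx.
Qed.

Lemma cell_mon_gt0 i j e : 0 < cell_mon i j (enum_rank e) -> crow e = i /\ ccol e = j.
Proof.
rewrite /cell_mon; case: pickP => [e' /andP[/eqP r /eqP c]|]; last by rewrite mnm0E.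
by rewrite mnm1E; case: eqP => // /enum_rank_inj <-.
Qed.

Definition antidiag_mon b : 'X_{1..#|Xplus n|} :=
  (\sum_(i < (pf_half b).*2 | (i < pf_half b)%N)
     cell_mon (ent b i) (ent b ((pf_half b).*2 - i.+1)))%MM.

(** The rows of an antidiagonal are distinct, so its monomial is squarefree and divisibility only
    asks that each of its variables occur. *)
Lemma antidiag_monP b u : (antidiag_mon b <= u)%MM <->
  forall k, k < pf_half b -> exists e, [/\ crow e = ent b k,
    ccol e = ent b ((pf_half b).*2 - k.+1) & 0 < u (enum_rank e)].
Proof.
have cellb k : k < pf_half b -> exists2 e : Xplus n, crow e = ent b k &
    ccol e = ent b ((pf_half b).*2 - k.+1).
  move=> lt_k; have := @ent_lt b k ((pf_half b).*2 - k.+1).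
  have := @ent_ltn b ((pf_half b).*2 - k.+1).
  by move=> /(_ ltac:(lia)) lt_n /(_ ltac:(lia)) lt_kl; apply: cellP lt_kl lt_n.
split=> [/mnm_lepP le k lt_k|occ].
  have [e re ce] := cellb k lt_k; exists e; split=> //.
  apply: leq_trans (le (enum_rank e)); rewrite mnm_sumE.
  have lt_k2 : k < (pf_half b).*2 by lia.
  rewrite (bigD1 (Ordinal lt_k2)) //= -re -ce cell_monE mnm1E eqxx; lia.
apply/mnm_lepP=> i; rewrite -(enum_valK i); set e := enum_val i; rewrite mnm_sumE.
have [[k lt_k /eqP re]|none] := pickP [pred k : 'I_(pf_half b) | crow e == ent b k].
  have [e' [re' ce' occe]] := occ k lt_k.
  have lt_k2 : k < (pf_half b).*2 by lia.
  rewrite (bigD1 (Ordinal lt_k2)) //= big1 ?addn0 => [|j /andP[lt_j nej]].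
    rewrite -re' -ce' cell_monE mnm1E; case: eqP => // /enum_rank_inj <-.
    by move: occe; case: (u _).
  apply/eqP; rewrite -leqn0 leqNgt; apply: contra nej => /cell_mon_gt0[ej _].
  rewrite -val_eqE /=; case: (ltngtP (j : nat) (k : nat)) => // lt.
    by have := @ent_lt b j k; rewrite lt lt_k2 -re -ej ltnn => /(_ isT).
  by have := @ent_lt b k j; rewrite lt ltn_ord -re -ej ltnn => /(_ isT).
rewrite big1 // => j lt_j; apply/eqP; rewrite -leqn0 leqNgt; apply/negP.
by case/cell_mon_gt0=> ej _; have := none (Ordinal lt_j); rewrite /= ej eqxx.
Qed.

End PfaffianEntries.

Arguments cell_mon n i j : clear implicits.

(** * Perfect matchings encoded as permutations *)

Section Matchings.

Lemma matching_permP t (s : 'S_(t.*2)) : reflect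
  ((forall k, s (ord_even k) < s (ord_odd k))%N /\
   forall k l : 'I_t, (k < l)%N -> (s (ord_even k) < s (ord_even l))%N)
  (matching_perm s).
Proof.
apply: (iffP andP) => -[/forallP h1 h2]; split=> //.
  by move=> k l; move/forallP/(_ k)/forallP/(_ l)/implyP: h2.
by apply/forallP=> k; apply/forallP=> l; apply/implyP/h2.
Qed.

Variable t : nat.
Local Notation T := t.+1.
Local Notation last := (t.*2.+1).
Implicit Types s : 'S_(T.*2).

Lemma even_neq_odd s k l : s (ord_even k) <> s (ord_odd l).
Proof. by move=> /perm_inj/(congr1 val) /=; lia. Qed.

Lemma ord_even_inj (k l : 'I_T) : ord_even k = ord_even l -> k = l.
Proof. by move=> /(congr1 val) /= /double_inj; apply: val_inj. Qed.

Lemma ord_odd_inj (k l : 'I_T) : ord_odd k = ord_odd l -> k = l.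
Proof. by move=> /(congr1 val) /= [] /double_inj; apply: val_inj. Qed.

Lemma matching_even_ge s (k : 'I_T) : matching_perm s -> (k <= s (ord_even k))%N.
Proof.
move=> /matching_permP[_ incr]; case: k => k; elim: k => // k IHk lt_k.
have lt_k' := ltnW lt_k; apply: leq_ltn_trans (IHk lt_k') _.
exact: (incr (Ordinal lt_k') (Ordinal lt_k)).
Qed.

Lemma matching_even0 s : matching_perm s -> s (ord_even ord0) = 0 :> nat.
Proof.
move=> /matching_permP[lt incr]; apply/eqP; rewrite -leqn0 leqNgt; apply/negP=> gt0.
have pos k : (0 < s (ord_even k))%N.
  have [->//|nz] := eqVneq k ord0; apply: ltn_trans gt0 (incr _ _ _).
  by rewrite lt0n.
have sj : s (s^-1%g ord0) = ord0 by rewrite permKV.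
have : (s^-1%g ord0 < T.*2)%N by [].
move: (s^-1%g ord0) sj => j sj lt_j.
have lt_k : (j./2 < T)%N by lia.
have [odd_j|even_j] := boolP (odd j).
  have ej : j = ord_odd (Ordinal lt_k) by apply: val_inj; rewrite /=; lia.
  rewrite ej in sj; by have := lt (Ordinal lt_k); rewrite sj.
have ej : j = ord_even (Ordinal lt_k) by apply: val_inj; rewrite /=; lia.
rewrite ej in sj; by have := pos (Ordinal lt_k); rewrite sj.
Qed.

Lemma odd_position s (j : 'I_(T.*2)) : (forall k, s (ord_even k) <> j) ->
  exists k, s (ord_odd k) = j.
Proof.
move=> nev; have sj : s (s^-1%g j) = j by rewrite permKV.
have : (s^-1%g j < T.*2)%N by [].
move: (s^-1%g j) sj => i si lt_i; have lt_k : (i./2 < T)%N by lia.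
exists (Ordinal lt_k); rewrite -si; congr (s _); apply: val_inj => /=.
have [odd_i|even_i] := boolP (odd i); first by lia.
case: (nev (Ordinal lt_k)); rewrite -si; congr (s _); apply: val_inj => /=; lia.
Qed.

(** The pairs are listed by increasing left ends, so the set of pairs determines the permutation. *)
Lemma matching_perm_inj s s' : matching_perm s -> matching_perm s' ->
    (forall k, exists l,
       s (ord_even k) = s' (ord_even l) /\ s (ord_odd k) = s' (ord_odd l)) ->
    (forall k, exists l,
       s' (ord_even k) = s (ord_even l) /\ s' (ord_odd k) = s (ord_odd l)) ->
  s = s'.
Proof.
have le_even s1 s2 : matching_perm s1 -> matching_perm s2 ->
    (forall k, exists l,
       s1 (ord_even k) = s2 (ord_even l) /\ s1 (ord_odd k) = s2 (ord_odd l)) ->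
    forall k l : 'I_T, s1 (ord_even k) = s2 (ord_even l) -> (k <= l)%N.
  move=> /matching_permP[_ inc1] /matching_permP[_ inc2] sub [k lt_k] /=.
  elim: k lt_k => // k IHk lt_k l el; have lt_k' := ltnW lt_k.
  have [l' [el' _]] := sub (Ordinal lt_k'); have le_kl' := IHk _ _ el'.
  apply: leq_ltn_trans le_kl' _; rewrite ltnNge; apply/negP=> le_ll'.
  have : (s2 (ord_even l) <= s2 (ord_even l'))%N.
    move: le_ll'; rewrite leq_eqVlt => /orP[/eqP/val_inj->|/inc2/ltnW] //.
  by rewrite -el -el' leqNgt (inc1 (Ordinal lt_k') (Ordinal lt_k)).
move=> ms ms' sub sub'; have eq_pair k :
    s (ord_even k) = s' (ord_even k) /\ s (ord_odd k) = s' (ord_odd k).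
  have [l [el ol]] := sub k; suff ekl : k = l by rewrite -ekl in el ol.
  apply: val_inj; apply/eqP; rewrite eqn_leq (le_even _ _ ms ms' sub k l el) /=.
  exact: (le_even _ _ ms' ms sub').
apply/permP=> j; have lt_k : (j./2 < T)%N by move: (ltn_ord j); lia.
have [e o] := eq_pair (Ordinal lt_k); have [odd_j|even_j] := boolP (odd j).
  by have -> : j = ord_odd (Ordinal lt_k) by apply: val_inj; rewrite /=; lia.
by have -> : j = ord_even (Ordinal lt_k) by apply: val_inj; rewrite /=; lia.
Qed.

Definition lift2 (s : 'S_(t.*2)) : 'S_(T.*2) :=
  lift_perm ord_max ord_max (lift_perm ord_max ord_max s).

Lemma lift2E (s' : 'S_(t.*2)) (j : 'I_(T.*2)) : lift2 s' j = (if insub (val j) is Some i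
  then s' i else j) :> nat.
Proof.
rewrite /lift2; case: insubP => [i lt_i ei|ge_j].
  have -> : j = lift ord_max (lift ord_max i).
    by apply: ord_inj; rewrite !lift_max -ei.
  by rewrite !lift_perm_lift !lift_max.
have lt_t : (t.*2 < (t.*2).+1)%N by [].
have [->|nj] := eqVneq j ord_max; first by rewrite lift_perm_id.
have -> : j = lift ord_max ord_max.
  have {}nj : (nat_of_ord j != last)%N by apply: contra nj => /eqP ej; apply/eqP/ord_inj.
  apply: ord_inj; rewrite lift_max -[RHS]/(t.*2).
  have {}ge_j : ~~ (nat_of_ord j < t.*2)%N := ge_j.
  by have := ltn_ord j; move: (nat_of_ord j) nj ge_j => x; rewrite doubleS; lia.
by rewrite lift_perm_lift lift_perm_id.
Qed.

Lemma lift2_even (s' : 'S_(t.*2)) (k : 'I_t) (k' : 'I_T) : k = k' :> nat ->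
  lift2 s' (ord_even k') = s' (ord_even k) :> nat.
Proof.
move=> ek; rewrite lift2E; case: insubP => [i _ ei|] /=; last by have := ltn_ord k; lia.
by congr (nat_of_ord (s' _)); apply: val_inj; rewrite /= in ei *; lia.
Qed.

Lemma lift2_odd (s' : 'S_(t.*2)) (k : 'I_t) (k' : 'I_T) : k = k' :> nat ->
  lift2 s' (ord_odd k') = s' (ord_odd k) :> nat.
Proof.
move=> ek; rewrite lift2E; case: insubP => [i _ ei|] /=; last by have := ltn_ord k; lia.
by congr (nat_of_ord (s' _)); apply: val_inj; rewrite /= in ei *; lia.
Qed.

Lemma lift2_last (s' : 'S_(t.*2)) :
  lift2 s' (ord_even ord_max) = t.*2 :> nat /\ lift2 s' (ord_odd ord_max) = last :> nat.
Proof. by rewrite !lift2E !insubF //=; lia. Qed.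

Lemma odd_lift2 (s' : 'S_(t.*2)) : odd_perm (lift2 s') = odd_perm s'.
Proof. by rewrite /lift2 !odd_lift_perm !addbb. Qed.

Lemma lift2_inj : injective lift2.
Proof.
move=> s1 s2 eqs; apply/permP=> j; apply: val_inj => /=.
have lt_j : (j < T.*2)%N by have := ltn_ord j; lia.
have := congr1 (fun s : 'S_(T.*2) => nat_of_ord (s (Ordinal lt_j))) eqs.
rewrite !lift2E; case: insubP => [i _ ei|]; last by rewrite /= ltn_ord.
by have -> : i = j by apply: val_inj.
Qed.

Lemma lift2_matching (s' : 'S_(t.*2)) : matching_perm (lift2 s') = matching_perm s'.
Proof.
have [emax omax] := lift2_last s'.
have caseT (k : 'I_T) : k = ord_max \/ exists k' : 'I_t, k' = k :> nat.
  have [->|nk] := eqVneq k ord_max; [by left|right].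
  have lt_k : (k < t)%N.
    by have := ltn_ord k; move: nk; rewrite -val_eqE /=; lia.
  by exists (Ordinal lt_k).
apply/matching_permP/matching_permP=> -[lt incr]; split.
- move=> k; have lt_k : (k < T)%N := leqW (ltn_ord k).
  by have := lt (Ordinal lt_k); rewrite (lift2_even s' (k := k)) // (lift2_odd s' (k := k)).
- move=> k l lt_kl; have lt_k : (k < T)%N := leqW (ltn_ord k).
  have lt_l : (l < T)%N := leqW (ltn_ord l).
  by have := incr (Ordinal lt_k) (Ordinal lt_l) lt_kl; 
    rewrite (lift2_even s' (k := k)) // (lift2_even s' (k := l)).
- move=> k; have [->|[k' ek]] := caseT k; first by rewrite emax omax.
  by rewrite (lift2_even s' ek) (lift2_odd s' ek).
move=> k l lt_kl; have [ek|[k' ek]] := caseT k.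
  by have := ltn_ord l; rewrite ltnS leqNgt -[X in (X < _)%N]/(nat_of_ord (@ord_max t)) -ek lt_kl.
have [->|[l' el]] := caseT l; first by rewrite emax (lift2_even s' ek).
by rewrite (lift2_even s' ek) (lift2_even s' el) incr // ek el.
Qed.

Lemma lift2_surj s :
    s (ord_even ord_max) = t.*2 :> nat -> s (ord_odd ord_max) = last :> nat ->
  exists s' : 'S_(t.*2), lift2 s' = s.
Proof.
move=> es os; have lt_s (j : 'I_(t.*2)) (lt_j : (j < T.*2)%N) :
    (s (Ordinal lt_j) < t.*2)%N.
  have lt_t := ltn_ord j; have := ltn_ord (s (Ordinal lt_j)).
  have ne : s (Ordinal lt_j) <> s (ord_even ord_max).
    by move=> /perm_inj/(congr1 val) /=; lia.
  have no : s (Ordinal lt_j) <> s (ord_odd ord_max).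
    by move=> /perm_inj/(congr1 val) /=; lia.
  have {}ne : s (Ordinal lt_j) <> t.*2 :> nat.
    by move=> e; apply/ne/ord_inj; rewrite es e.
  have {}no : s (Ordinal lt_j) <> last :> nat.
    by move=> e; apply/no/ord_inj; rewrite os e.
  by move: (nat_of_ord (s _)) ne no => x; lia.
have lt_j (j : 'I_(t.*2)) : (j < T.*2)%N by have := ltn_ord j; lia.
pose phi (j : 'I_(t.*2)) := Ordinal (lt_s j (lt_j j)).
have phi_inj : injective phi.
  by move=> j1 j2 /(congr1 val) /= /val_inj/perm_inj/(congr1 val) /= /val_inj.
exists (perm phi_inj); apply/permP=> j; apply: val_inj; rewrite [LHS]lift2E.
case: insubP => [i lt_i ei|ge_j] /=.
  by rewrite permE /=; congr (nat_of_ord (s _)); apply: val_inj.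
rewrite -leqNgt /= in ge_j; have := ltn_ord j; have [ej|nej] := eqVneq (nat_of_ord j) t.*2.
  have -> : j = ord_even ord_max by apply: ord_inj.
  by move=> _; rewrite /= es.
move=> ltj; have ej : j = last :> nat by move: (nat_of_ord j) ge_j nej ltj => x; lia.
have -> : j = ord_odd ord_max by apply: ord_inj.
by rewrite /= os.
Qed.

(** Isolates the matchings that pair the last two positions with each other: the terms that [S]
    [e x y z] cancels. *)
Lemma sum_lift2 (V : nmodType) (F : 'S_(T.*2) -> V) :
 (\sum_(s | matching_perm s && (s (ord_even ord_max) == t.*2 :> nat) &&
             (s (ord_odd ord_max) == last :> nat)) F s)%R =
  (\sum_(s' : 'S_(t.*2) | matching_perm s') F (lift2 s'))%R.
Proof.
pose inv s := odflt 1%g [pick s' | lift2 s' == s].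
have invK (s' : 'S_(t.*2)) : inv (lift2 s') = s'.
  rewrite /inv; case: pickP => [s1 /eqP/lift2_inj //|/(_ s')].
  by rewrite eqxx.
rewrite (reindex_onto lift2 inv) /=; last first.
  by move=> s /andP[/andP[_ /eqP es] /eqP os]; have [s' <-] := lift2_surj es os; rewrite invK.
apply: eq_bigl => s'; have [-> ->] := lift2_last s'.
by rewrite !eqxx !andbT invK eqxx andbT lift2_matching.
Qed.

End Matchings.

(** * The initial ideal of a G-Pfaffian ideal *)

Section InitialIdeal.
Variables (K : fieldType) (n : nat).
Implicit Types (alpha b : pf_index n) (ord : rel 'X_{1..#|Xplus n|}).
Local Open Scope ring_scope.

Lemma Xmx_cell_mon (i j : 'I_n) : (i < j)%N -> Xmx K n i j = 'X_[cell_mon n i j].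
Proof.
move=> lt_ij; rewrite mxE insubT /Xvar; set e := Sub _ _.
have re : crow e = i by rewrite /crow SubK.
have ce : ccol e = j by rewrite /ccol SubK.
by rewrite -re -ce cell_monE.
Qed.

Lemma antidiagonal_productE b : antidiagonal_product K b = 'X_[antidiag_mon b].
Proof.
rewrite /antidiagonal_product /antidiag_mon -mprodXE; apply: eq_bigr => i lt_i.
rewrite Xmx_cell_mon ?ent_tnth //=; apply: ent_lt; move: (ltn_ord i) lt_i; lia.
Qed.

Lemma antidiag_initial ord b :
  antidiagonal K ord -> is_initial_monomial ord (pf K b) (antidiag_mon b).
Proof.
case=> _ /(_ b)[u Xu]; suff <- : u = antidiag_mon b by [].
move: Xu; rewrite antidiagonal_productE => /(congr1 (fun f => msupp f)).
by rewrite !msuppX => -[].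
Qed.

Lemma initial_ideal_monomial ord alpha w :
    G_pfaffian K alpha -> antidiagonal K ord ->
  initial_ideal ord (cogenerated_ideal alpha) ('X_[w] : {mpoly K[#|Xplus n|]}) <->
  exists2 b, ~ pf_le alpha b & (antidiag_mon b <= w)%MM.
Proof.
move=> Galpha ordA; rewrite (Galpha _ ordA).2 ideal_gen_monomial; last first.
  by move=> _ [_ [u [_ _ ->]]]; exists u.
have [[_ anti _ _ _] _] := ordA.
split=> [[u [_ [v [[b badb ->] [supp_v vmax]]]]]|[b badb le_bw]]; last first.
  exists (antidiag_mon b) => //; exists (pf K b), (antidiag_mon b); split=> //.
    by exists b.
  exact: antidiag_initial.
move=> /(congr1 (fun f => msupp f)); rewrite !msuppX => -[->] le_vw.
exists b => //; have [supp_b bmax] := antidiag_initial b ordA.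
by rewrite (anti (antidiag_mon b) v) // vmax // bmax.
Qed.

Lemma DeltaP ord alpha (Z : {set Xplus n}) :
    G_pfaffian K alpha -> antidiagonal K ord ->
  Delta K ord alpha Z <-> forall b, ~ pf_le alpha b ->
    ~ forall k, (k < pf_half b)%N -> exists2 e, e \in Z &
        crow e = ent b k /\ ccol e = ent b ((pf_half b).*2 - k.+1).
Proof.
move=> Galpha ordA; pose w : 'X_{1..#|Xplus n|} := (\sum_(e in Z) U_(enum_rank e))%MM.
have wE e : w (enum_rank e) = (e \in Z).
  rewrite mnm_sumE; have [Ze|Ze] := boolP (e \in Z).
    rewrite (bigD1 e) //= mnm1E eqxx big1 // => e' /andP[_ ne].
    by rewrite mnm1E (inj_eq enum_rank_inj) (negPf ne).
  by rewrite big1 // => e' Ze'; rewrite mnm1E (inj_eq enum_rank_inj);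
    case: eqP Ze' Ze => // -> ->.
have leE b : (antidiag_mon b <= w)%MM <-> forall k, (k < pf_half b)%N ->
    exists2 e, e \in Z & crow e = ent b k /\ ccol e = ent b ((pf_half b).*2 - k.+1).
  rewrite antidiag_monP; split=> occ k /occ => [[e [? ? +]]|[e Ze [? ?]]].
    by rewrite wE lt0b => Ze; exists e.
  by exists e; rewrite wE Ze.
rewrite /Delta; have -> : \prod_(e in Z) Xvar K e = 'X_[w] by rewrite mprodXE.
rewrite (initial_ideal_monomial _ Galpha ordA).
split=> [nex b badb /leE le_bw|nall [b badb /leE]].
  by apply: nex; exists b.
exact: nall.
Qed.

(** The form in which the Gröbner property is contradicted: the initial monomial of [f] must be
    divisible by some bad antidiagonal. *)
Lemma cogenerated_ideal_support ord alpha (f : {mpoly K[#|Xplus n|]}) :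
    G_pfaffian K alpha -> antidiagonal K ord ->
    cogenerated_ideal alpha f -> f != 0 ->
  exists u b, [/\ u \in msupp f, ~ pf_le alpha b & (antidiag_mon b <= u)%MM].
Proof.
move=> Galpha ordA If nz_f; have [ord_term _] := ordA.
have [u fu] := initial_monomial_exists ord_term nz_f.
have /(initial_ideal_monomial _ Galpha ordA)[b badb le_bu] :
    initial_ideal ord (cogenerated_ideal alpha) ('X_[u] : {mpoly K[#|Xplus n|]}).
  by apply: ideal_gen_mem; exists f, u.
by exists u, b; split=> //; case: fu.
Qed.

Definition matching_mon t (h : nat -> nat) (s : 'S_(t.*2)) : 'X_{1..#|Xplus n|} :=
  (\sum_(k < t) cell_mon n (h (s (ord_even k))) (h (s (ord_odd k))))%MM.

(** The Pfaffian on the indices [h 0, h 1, ...] without a proof that they increase, so that several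
    choices of letters can be compared matching by matching. *)
Definition pf_poly t (h : nat -> nat) : {mpoly K[#|Xplus n|]} :=
  \sum_(s : 'S_(t.*2) | matching_perm s) (-1) ^+ s * 'X_[matching_mon h s].

Lemma pf_pf_poly b h : (forall k, (k < (pf_half b).*2)%N -> ent b k = h k) ->
  pf K b = pf_poly (pf_half b) h.
Proof.
move=> entE; apply: eq_bigr => s /matching_permP[lts _]; congr (_ * _).
rewrite /matching_mon -mprodXE; apply: eq_bigr => k _.
rewrite mxE Xmx_cell_mon; first by rewrite !ent_tnth !entE.
by rewrite !ent_tnth; apply: ent_lt; rewrite lts ltn_ord.
Qed.

Lemma pf_poly_exists t h : (0 < t)%N ->
    (forall k l, k < l < t.*2 -> h k < h l)%N -> (forall k, k < t.*2 -> h k < n)%N ->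
  exists b, [/\ pf_half b = t, forall k, (k < t.*2)%N -> ent b k = h k
              & pf K b = pf_poly t h].
Proof.
move=> t_gt0 incr lt_hn; have [b [eqt entE]] := pf_index_exists t_gt0 incr lt_hn.
by exists b; rewrite -eqt; split=> //; [rewrite eqt|apply: pf_pf_poly; rewrite eqt].
Qed.

End InitialIdeal.

(** * G-Pfaffians have consecutive entries *)

Section Gap.
Variables (K : fieldType) (n : nat) (alpha : pf_index n).
(** [E] is the sequence of entries of [alpha] with a new value [E i0] inserted in the gap. The
    indices up to [i0] give S, with [E 0] as e; the [w.+1] indices after them are the letters, of
    which a Pfaffian of size [T.*2] beginning with S uses [w]. *)
Variables (i0 w t : nat) (E : nat -> nat).
Local Notation T := t.+1.
Local Notation last := (t.*2.+1).
Local Notation P := {mpoly K[#|Xplus n|]}.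
Local Open Scope ring_scope.
Implicit Types (g : nat -> nat) (s : 'S_(T.*2)).

Hypothesis E_lt : forall k l, (k < l <= T.*2)%N -> (E k < E l)%N.
Hypothesis E_ltn : forall k, (k <= T.*2)%N -> (E k < n)%N.
Hypothesis alphaE : forall k, (k < T.*2)%N ->
  ent alpha k = if (k < i0)%N then E k else E k.+1.
Hypothesis le_T : (T <= pf_half alpha)%N.
Hypothesis i0w : (i0 + w).+1 = T.*2.
Hypothesis w_gt0 : (0 < w)%N.

Lemma E_inj k l : (k <= T.*2)%N -> (l <= T.*2)%N -> E k = E l -> k = l.
Proof.
move=> le_k le_l eqE; case: (ltngtP k l) => // lt.
  by have := @E_lt k l; rewrite lt le_l eqE ltnn => /(_ isT).
by have := @E_lt l k; rewrite lt le_k eqE ltnn => /(_ isT).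
Qed.

(** The entry at position [i0] is [E i0], below the entry [E i0.+1] of [alpha]. *)
Lemma pf_poly_cogenerated r g :
    (i0 < r.*2)%N -> (forall k l, k < l < r.*2 -> g k < g l)%N ->
    (forall k, k < r.*2 -> g k <= T.*2)%N -> g i0 = i0 ->
  cogenerated_ideal alpha (pf_poly K n r (E \o g)).
Proof.
move=> lt_i0r incr le_g gi0; have r_gt0 : (0 < r)%N by move: lt_i0r; case: (r).
have [|k lt_k|b [half_b entb <-]] := @pf_poly_exists K n r (E \o g) r_gt0.
- by move=> k l /andP[lt_kl lt_l]; apply: E_lt; rewrite incr ?lt_kl // le_g.
- by apply/E_ltn/le_g.
apply: ideal_gen_mem; exists b => //; apply/not_pf_leP; right.
exists i0; rewrite ?half_b // entb //= gi0 alphaE; last by lia.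
by rewrite ltnn; apply: E_lt; lia.
Qed.

(** The k-th entry of an increasing selection from [E] is at least [E k]. Falling below [alpha] at k
    forces it to be [E k] with [i0 <= k], and then no earlier index can have been skipped. There are
    only 2T + 1 values, which bounds the length. *)
Lemma ent_prefix b j : (forall k, k < (pf_half b).*2 ->
      exists2 l, ent b k = E l & l <= T.*2)%N ->
    ~ pf_le alpha b ->
  [/\ (pf_half b <= T)%N, (i0 < (pf_half b).*2)%N & ((j <= i0)%N -> ent b j = E j)].
Proof.
move=> entE badb.
have le_ent k l : (k < (pf_half b).*2)%N -> (l <= T.*2)%N -> ent b k = E l -> (k <= l)%N.
  elim: k l => // k IHk l lt_k le_l ekl.
  have [l' ekl' le_l'] := entE k (ltnW lt_k).
  have := IHk l' (ltnW lt_k) le_l' ekl' => /leq_ltn_trans; apply.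
  rewrite ltnNge; apply/negP => le_ll'.
  have : (E l <= E l')%N.
    by move: le_ll'; rewrite leq_eqVlt => /predU1P[-> //|lt]; rewrite ltnW // E_lt // lt.
  by rewrite -ekl -ekl' leqNgt ent_lt // ltnSn.
have le_half : (pf_half b <= T)%N.
  rewrite leqNgt; apply/negP=> lt_T.
  have lt_l : ((pf_half b).*2.-1 < (pf_half b).*2)%N by lia.
  by have [l el le_l] := entE _ lt_l; have := le_ent _ _ lt_l le_l el; lia.
have prefix k l : (k < (pf_half b).*2)%N -> ent b k = E k -> (l <= k)%N -> ent b l = E l.
  elim: k => [|k IHk] lt_k ek; first by rewrite leqn0 => /eqP->.
  rewrite leq_eqVlt => /predU1P[->//|]; apply: IHk; first exact: ltnW.
  have [l' ekl' le_l'] := entE k (ltnW lt_k); rewrite ekl'; congr E.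
  apply/eqP; rewrite eqn_leq (le_ent k) ?(ltnW lt_k) // andbT.
  rewrite -ltnS ltnNge; apply/negP => le_l.
  have : (E k.+1 <= E l')%N.
    by move: le_l; rewrite leq_eqVlt => /predU1P[-> //|lt]; rewrite ltnW // E_lt // lt.
  by rewrite -ek -ekl' leqNgt ent_lt // ltnSn.
have [lt|[k lt_k lt_ent]] := (not_pf_leP _ _).1 badb.
  by have := leq_trans lt le_half; rewrite ltnNge le_T.
have lt_kT : (k < T.*2)%N by apply: leq_trans lt_k _; rewrite leq_double.
have [l el le_l] := entE k lt_k; have le_kl := le_ent _ _ lt_k le_l el.
have le_E k1 l1 : (k1 <= l1 <= T.*2)%N -> (E k1 <= E l1)%N.
  by case/andP; rewrite leq_eqVlt => /predU1P[->//|lt le]; rewrite ltnW // E_lt // lt.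
rewrite alphaE // el in lt_ent; move: lt_ent; case: (ltnP k i0) => [lt_ki0|le_i0k] lt_E.
  by move: lt_E; rewrite ltnNge le_E // le_kl.
have lk : l = k.
  apply/eqP; rewrite eqn_leq le_kl andbT -ltnS ltnNge; apply/negP=> le.
  by move: lt_E; rewrite ltnNge le_E // le.
rewrite lk in el; split=> //; first exact: leq_ltn_trans lt_k.
by move=> le_j; apply: (prefix k) => //; apply: leq_trans le_i0k.
Qed.

(* A pattern g selects indices of E: it keeps the prefix 0 ... i0 and replaces the
   remaining positions by letters. *)
Definition letters g := (forall j, (j <= i0)%N -> g j = j) /\
  (forall j, (i0 < j < T.*2)%N -> (i0 < g j <= T.*2)%N).

Lemma matching_mon_gt0 g s e : (0 < matching_mon n (E \o g) s (enum_rank e))%N ->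
  exists k, crow e = E (g (s (ord_even k))) /\ ccol e = E (g (s (ord_odd k))).
Proof.
rewrite mnm_sumE => gt0; have [k gtk|none] := pickP (fun k : 'I_T =>
  0 < cell_mon n (E (g (s (ord_even k)))) (E (g (s (ord_odd k)))) (enum_rank e))%N.
  by exists k; apply: cell_mon_gt0 gtk.
by rewrite big1 // in gt0 => k _; apply/eqP; rewrite -leqn0 leqNgt none.
Qed.

(* Both endpoints of the cell of the antidiagonal of b meeting the p-th row or
   column lie in the common prefix E 0 ... E i0, whereas the matching sends p to
   one of the letters after the prefix. *)
Lemma antidiag_avoid g s om k0 b : letters g -> (i0 < om <= T.*2)%N ->
    (w <= s (ord_even k0) <= i0)%N -> (i0 < s (ord_odd k0))%N ->
    ~ pf_le alpha b ->
  ~ (antidiag_mon b <= cell_mon n (E 0) (E om) + matching_mon n (E \o g) s)%MM.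
Proof.
move=> [g_id g_gt] /andP[om_gt om_le] /andP[le_wp le_pi] p_out badb.
set p : nat := s _ in le_wp le_pi.
have g_le (j : 'I_(T.*2)) : (g j <= T.*2)%N.
  have [le_j|lt_j] := leqP j i0; first by rewrite g_id // ltnW.
  by have := g_gt j; rewrite lt_j ltn_ord => /(_ isT) /andP[].
rewrite antidiag_monP => cellb.
have cellP' k : (k < pf_half b)%N -> exists2 e : Xplus n, crow e = ent b k /\
    ccol e = ent b ((pf_half b).*2 - k.+1) & crow e = E 0 /\ ccol e = E om \/
    exists l, crow e = E (g (s (ord_even l))) /\ ccol e = E (g (s (ord_odd l))).
  case/cellb=> e [re ce]; rewrite mnmDE addn_gt0 => gt0; exists e => //.
  by case/orP: gt0 => [/cell_mon_gt0|/matching_mon_gt0]; [left|right].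
have entE k : (k < (pf_half b).*2)%N -> exists2 l, ent b k = E l & (l <= T.*2)%N.
  move=> lt_k; have [lt|ge] := ltnP k (pf_half b).
    have [e [<- _] [[-> _]|[l [-> _]]]] := cellP' k lt; first by exists 0%N.
    by exists (g (s (ord_even l))).
  have lt : ((pf_half b).*2 - k.+1 < pf_half b)%N by lia.
  have [e [_ ce] ecase] := cellP' _ lt; rewrite (_ : _ - _ = k)%N in ce; last by lia.
  rewrite -ce; case: ecase => [[_ ->]|[l [_ ->]]]; first by exists om.
  by exists (g (s (ord_odd l))).
have [le_half lt_i0b _] := ent_prefix 0 entE badb.
have entb j : (j <= i0)%N -> ent b j = E j.
  by have [_ _] := ent_prefix j entE badb.
have le_iT : (i0 <= T.*2)%N by lia.
(* The partner of [p] in the antidiagonal of [b]. It lies in the prefix because [w <= p] and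
   [(pf_half b).*2 <= T.*2], which is [i0 + w + 1]. *)
pose p' := ((pf_half b).*2 - p.+1)%N.
have le_p' : (p' <= i0)%N by rewrite /p'; lia.
have p_gt0 : (0 < p)%N by apply: leq_trans le_wp.
have E_inj' k (j : 'I_(T.*2)) : (k <= i0)%N -> E (g j) = E k -> j = k :> nat.
  move=> le_k /(E_inj (g_le _) (leq_trans le_k le_iT)) gjk.
  have [le_j|lt_j] := leqP j i0; first by rewrite -(g_id j).
  by have := g_gt j; rewrite lt_j ltn_ord gjk ltnNge le_k => /(_ isT).
have [lt|ge] := ltnP p (pf_half b).
  have [e [re ce] [[re' ce']|[l [re' ce']]]] := cellP' p lt.
    move: re; rewrite re' entb // => /(E_inj (leq0n _) (leq_trans le_pi le_iT)) e0.
    by rewrite -e0 in p_gt0.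
  move: re ce; rewrite re' ce' -/p' !entb // => /(E_inj' _ _ le_pi) el.
  move=> /(E_inj' _ _ le_p'); have -> : l = k0.
    by apply/ord_even_inj/(@perm_inj _ s)/val_inj.
  by move=> ep'; rewrite ep' ltnNge le_p' in p_out.
have lt : (p' < pf_half b)%N by rewrite /p'; lia.
have [e [re ce] [[re' ce']|[l [re' ce']]]] := cellP' p' lt; move: ce; rewrite ce'.
  rewrite (_ : _ - _ = p)%N; last by rewrite /p'; lia.
  rewrite entb // => /(E_inj om_le (leq_trans le_pi le_iT)) e0.
  by rewrite e0 ltnNge le_pi in om_gt.
rewrite (_ : _ - _ = p)%N; last by rewrite /p'; lia.
rewrite entb // => /(E_inj' _ _ le_pi) ep; apply: (@even_neq_odd t s k0 l).
exact/val_inj/esym.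
Qed.

Lemma matching_mon_pos (h : nat -> nat) s k e : crow e = h (s (ord_even k)) ->
  ccol e = h (s (ord_odd k)) -> (0 < matching_mon n h s (enum_rank e))%N.
Proof.
move=> re ce; rewrite mnm_sumE (bigD1 k) //= -re -ce cell_monE mnm1E eqxx.
by rewrite addn_gt0.
Qed.

Lemma matching_mon_inj s s' : matching_perm s -> matching_perm s' ->
  matching_mon n E s = matching_mon n E s' -> s = s'.
Proof.
have le_ord (j : 'I_(T.*2)) : (j <= T.*2)%N by apply: ltnW.
have sub s1 s2 : matching_perm s1 -> matching_mon n E s1 = matching_mon n E s2 ->
    forall k, exists l, s1 (ord_even k) = s2 (ord_even l) /\ s1 (ord_odd k) = s2 (ord_odd l).
  move=> /matching_permP[lt1 _] eqm k.
  have [||e re ce] := @cellP n (E (s1 (ord_even k))) (E (s1 (ord_odd k))).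
  - by apply: E_lt; rewrite lt1 le_ord.
  - by apply: E_ltn; rewrite le_ord.
  have := matching_mon_pos re ce; rewrite eqm.
  case/(@matching_mon_gt0 id)=> l [re' ce']; exists l; split; apply: val_inj.
    by apply: E_inj; rewrite ?le_ord // -re -re'.
  by apply: E_inj; rewrite ?le_ord // -ce -ce'.
by move=> ms ms' eqm; apply: matching_perm_inj => //; apply: sub.
Qed.

(* The prefix position 0 is not matched to a letter, and no two letters are
   matched together. *)
Definition good s := (s (ord_odd ord0) <= i0)%N && [forall k, (s (ord_even k) <= i0)%N].

(** In a good matching the last position is paired with a prefix row other than the first. Since [g]
    sends it to [T.*2], the left side has a variable in column [E T.*2] outside row [E 0]; the right
    side has none. *)
Lemma last_col_neq g s s' u om : letters g -> g last = T.*2 ->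
    matching_perm s -> good s -> (om = T.*2 \/ om = 0)%N ->
  (u + matching_mon n (E \o g) s)%MM <> (cell_mon n (E 0) (E om) + matching_mon n E s')%MM.
Proof.
move=> [g_id _] g_last ms /andP[le0 /forallP le_even] omE.
have lt_last : (last < T.*2)%N by rewrite doubleS.
have le_ord (j : 'I_(T.*2)) : (j <= T.*2)%N by apply: ltnW.
have [k|k ek] := @odd_position t s (Ordinal lt_last).
  by move=> /(congr1 val) /= ek; have := le_even k; rewrite ek leqNgt; lia.
have lt_iT : (i0 < T.*2)%N by lia.
have nk0 : k != ord0.
  by apply: contraTneq le0 => k0; rewrite -k0 ek /=; lia.
have gp := g_id _ (le_even k).
have [||e re ce] := @cellP n (E (s (ord_even k))) (E (T.*2)).
- by apply: E_lt; rewrite ltn_ord /=.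
- exact: E_ltn.
move/mnmP/(_ (enum_rank e)); rewrite !mnmDE.
have : (0 < matching_mon n (E \o g) s (enum_rank e))%N.
  by apply: (@matching_mon_pos _ _ k); rewrite /= ?gp // ek /= g_last.
have -> : cell_mon n (E 0) (E om) (enum_rank e) = 0%N.
  apply/eqP; rewrite -leqn0 leqNgt; apply/negP=> /cell_mon_gt0[re0 _].
  move: re0; rewrite re => /(E_inj (le_ord _) (leq0n _)) e0.
  have := matching_even_ge k ms; rewrite e0 leqn0 => /eqP k0.
  by case/eqP: nk0; apply: val_inj.
have -> : matching_mon n E s' (enum_rank e) = 0%N.
  apply/eqP; rewrite -leqn0 leqNgt; apply/negP=> /(@matching_mon_gt0 id)[l [_ ce']].
  move: ce'; rewrite ce => /(E_inj (leqnn _) (le_ord _)).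
  by move=> el; have := ltn_ord (s' (ord_odd l)); rewrite /= -el ltnn.
by rewrite !addn0; case: (matching_mon _ _ _ _) => // ? _; rewrite addnS.
Qed.

Lemma mcoeff_sign (b : bool) (q : P) u : ((-1) ^+ b * q)@_u = (-1) ^+ b * q@_u.
Proof. by case: b => /=; rewrite ?(expr1, expr0, mulN1r, mul1r, mcoeffN). Qed.

(** [f] is nonzero, as nothing cancels the main monomial of [s0]; yet no monomial of [f] is
    divisible by a bad antidiagonal. Left ends increase, so the pair numbered at least [w] starts at
    a position at least [w], as [antidiag_avoid] requires. *)
Lemma gap_contradiction (ord : rel 'X_{1..#|Xplus n|}) N (sg : nat -> bool)
    (om : nat -> nat) (g : nat -> nat -> nat) s0 (f : P) :
    G_pfaffian K alpha -> antidiagonal K ord ->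
    (forall i, letters (g i) /\ g i last = T.*2) ->
    (forall i, i0 < om i <= T.*2)%N ->
    (forall s, matching_perm s -> good s ->
       exists2 k : 'I_T, (w <= k)%N & (i0 < s (ord_odd k))%N) ->
    matching_perm s0 -> good s0 -> cogenerated_ideal alpha f ->
    f = \sum_(s : 'S_(T.*2) | matching_perm s && good s) (-1) ^+ s *
         ('X_[cell_mon n (E 0) (E (T.*2)) + matching_mon n E s] +
          \sum_(i < N) (-1) ^+ sg i *
             'X_[cell_mon n (E 0) (E (om i)) + matching_mon n (E \o g i) s]) ->
  False.
Proof.
move=> Galpha ordA g_ok om_ok letter_match ms0 good0 If fE.
have nz_f : f != 0.
  apply/eqP => /(congr1 (mcoeff (cell_mon n (E 0) (E (T.*2)) + matching_mon n E s0)%MM)).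
  have letters0 s : matching_perm s -> good s ->
    (\sum_(i < N) (-1) ^+ sg i *
       'X_[cell_mon n (E 0) (E (om i)) + matching_mon n (E \o g i) s])@_
      (cell_mon n (E 0) (E (T.*2)) + matching_mon n E s0)%MM = 0 :> K.
    move=> ms goods; rewrite raddf_sum /= big1 // => i _.
    rewrite mcoeff_sign mcoeffX; case: eqP; rewrite ?mulr0 // => eqm.
    by have [gl glast] := g_ok i; case: (last_col_neq gl glast ms goods (or_introl erefl) eqm).
  rewrite fE mcoeff0 raddf_sum (bigD1 s0) ?ms0 //= [X in _ + X]big1.
    rewrite addr0 mcoeff_sign mcoeffD mcoeffX eqxx letters0 // addr0 mulr1.
    by move/eqP; rewrite signr_eq0.
  move=> s /andP[/andP[ms goods] ne]; rewrite mcoeff_sign mcoeffD mcoeffX letters0 //.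
  rewrite addr0; case: eqP => [eqm|]; last by rewrite mulr0.
  case/eqP: ne; apply: matching_mon_inj => //.
  by move: eqm; rewrite ![(cell_mon _ _ _ + _)%MM]addmC => /(can_inj (addmK _)).
have [u [b [uf badb le_bu]]] := cogenerated_ideal_support Galpha ordA If nz_f.
have [s [i [ms goods [g' [om' [g'_ok om'_ok eu]]]]]] : exists s (i : nat),
    [/\ matching_perm s, good s & exists g' om', [/\ letters g', (i0 < om' <= T.*2)%N
      & u = (cell_mon n (E 0) (E om') + matching_mon n (E \o g') s)%MM]].
  move: uf; rewrite fE => /msupp_sum_le /flattenP[supp /mapP[s]].
  rewrite mem_filter => /andP[/andP[ms goods] _] ->.
  rewrite mcoeff_msupp mcoeff_sign mcoeffD mcoeffX raddf_sum /=.
  case: (_ =P u) => [<- _|_].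
    exists s, 0%N; split=> //; exists id, (T.*2); split=> //; last first.
      by rewrite leqnn andbT; lia.
    by split=> // j /andP[-> /ltnW].
  rewrite add0r => nz; have [i eqi|none] := pickP (fun i : 'I_N =>
     (cell_mon n (E 0) (E (om i)) + matching_mon n (E \o g i) s)%MM == u).
    by exists s, i; split=> //; exists (g i), (om i); rewrite (eqP eqi); split=> //; case: (g_ok i).
  case/eqP: nz; rewrite big1 ?mulr0 // => i _.
  by rewrite mcoeff_sign mcoeffX none mulr0.
have [k le_wk out_k] := letter_match s ms goods.
apply: (antidiag_avoid g'_ok om'_ok (k0 := k) _ out_k badb); last by rewrite -eu.
rewrite (leq_trans le_wk) ?matching_even_ge //=.
by have /andP[_ /forallP] := goods.
Qed.

(** The source of all cancellations: when position 0 is paired with a letter, exchanging this letter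
    with that of the outer variable leaves the product unchanged. *)
Lemma matching_mon_eq (h h' : nat -> nat) s u u' : matching_perm s ->
    (forall j, (j < T.*2)%N -> j != s (ord_odd ord0) -> h j = h' j) ->
    (u + cell_mon n (h 0%N) (h (s (ord_odd ord0))) =
     u' + cell_mon n (h' 0%N) (h' (s (ord_odd ord0))))%MM ->
  (u + matching_mon n h s = u' + matching_mon n h' s)%MM.
Proof.
move=> ms eqh equ; rewrite /matching_mon (bigD1 ord0) // [in RHS](bigD1 ord0) //=.
rewrite (matching_even0 ms) ![(_ + (_ + _))%MM]addmA equ; congr (_ + _)%MM.
apply: eq_bigr => k nk0; congr (cell_mon n _ _); apply: eqh; rewrite ?ltn_ord //.
  by apply/eqP=> /ord_inj/even_neq_odd.
by apply: contra nk0 => /eqP/ord_inj/perm_inj/ord_odd_inj->.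
Qed.

Lemma mul_pf_poly r u h : 'X_[u] * pf_poly K n r h =
  \sum_(s : 'S_(r.*2) | matching_perm s) (-1) ^+ s * 'X_[u + matching_mon n h s].
Proof.
rewrite /pf_poly mulr_sumr; apply: eq_bigr => s _.
by rewrite mpolyXD mulrCA.
Qed.

Lemma odd_gap (ord : rel 'X_{1..#|Xplus n|}) :
  w = 1%N -> (0 < t)%N -> G_pfaffian K alpha -> antidiagonal K ord -> False.
Proof.
move=> w1 t_gt0 Galpha ordA.
have ei0 : i0 = t.*2 by move: i0w; rewrite w1; lia.
have lt_last : (last < T.*2)%N by rewrite doubleS.
pose g1 j := if (j == last)%N then T.*2 else j.
have evenP s : matching_perm s -> forall k, (s (ord_even k) <= i0)%N.
  move=> /matching_permP[lt _] k; have := lt k; have := ltn_ord (s (ord_odd k)); lia.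
pose f : P := 'X_[cell_mon n (E 0) (E (T.*2))] * pf_poly K n T E -
              'X_[cell_mon n (E 0) (E last)] * pf_poly K n T (E \o g1).
have g1_incr k l : (k < l < T.*2)%N -> (g1 k < g1 l)%N.
  by rewrite /g1; case: eqP; case: eqP; lia.
apply: (gap_contradiction (N := 1) (sg := fun=> true) (om := fun=> last)
  (g := fun=> g1) (s0 := 1%g) (f := f) Galpha ordA).
- move=> _; split; last by rewrite /g1 eqxx.
  by split=> j; rewrite /g1; case: eqP; lia.
- by move=> _; lia.
- move=> s ms /andP[le0 _].
  have [k|k ek] := @odd_position t s (Ordinal lt_last).
    by move=> /(congr1 val) /= ek; have := evenP s ms k; rewrite ek; lia.
  exists k; last by rewrite ek /=; lia.
  rewrite w1 lt0n; apply: contraTneq le0 => k0.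
  have <- : k = ord0 by apply: val_inj.
  by rewrite ek /=; lia.
- by apply/matching_permP; split=> *; rewrite !perm1 /=; lia.
- apply/andP; split; first by rewrite perm1 /=; lia.
  by apply/forallP=> k; rewrite perm1 /=; have := ltn_ord k; lia.
- apply: ideal_genB; apply: ideal_genM.
    by apply: (@pf_poly_cogenerated T id) => // *; lia.
  apply: pf_poly_cogenerated => //; first by lia.
    by move=> k lt_k; rewrite /g1; case: eqP; lia.
  by rewrite /g1; case: eqP; lia.
rewrite /f !mul_pf_poly -sumrB (bigID good) /= [X in _ + X]big1 ?addr0.
  by apply: eq_bigr => s _; rewrite big_ord1 expr1 mulN1r mulrBr.
(* With a single letter position, a matching that is not good pairs 0 with it, and its two terms
   coincide. *)
move=> s /andP[ms]; rewrite /good; case: forallP => [_|[]]; last exact: evenP.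
rewrite andbT -ltnNge => out0; have es : s (ord_odd ord0) = last :> nat.
  by have := ltn_ord (s (ord_odd ord0)); lia.
apply/eqP; rewrite subr_eq0; apply/eqP; congr (_ * 'X_[_]).
apply: (matching_mon_eq ms) => [j _|].
  by rewrite es /= /g1 => /negPf->.
by rewrite es /= /g1 eqxx /= addmC.
Qed.

Lemma matching_mon_lift2 (h : nat -> nat) (s' : 'S_(t.*2)) :
    matching_mon n h (lift2 s') =
  (matching_mon n h s' + cell_mon n (h t.*2) (h last))%MM.
Proof.
rewrite /matching_mon big_ord_recr /=; have [-> ->] := lift2_last s'.
congr (_ + _)%MM; apply: eq_bigr => k _.
by rewrite (lift2_even s' (k := k)) // (lift2_odd s' (k := k)).
Qed.

Lemma eq_matching_mon r (h h' : nat -> nat) (s : 'S_(r.*2)) :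
  (forall j, (j < r.*2)%N -> h j = h' j) -> matching_mon n h s = matching_mon n h' s.
Proof. by move=> eqh; apply: eq_bigr => k _; rewrite !eqh. Qed.

Lemma even_gap (ord : rel 'X_{1..#|Xplus n|}) :
  w = 2%N -> (1 < t)%N -> G_pfaffian K alpha -> antidiagonal K ord -> False.
Proof.
move=> w2 t_gt1 Galpha ordA.
have ei0 : i0 = t.*2.-1 by move: i0w; rewrite w2; lia.
have lt_L1 : (t.*2 < T.*2)%N by lia.
have lt_L2 : (last < T.*2)%N by lia.
have t2_0 : (t.*2 <= 0)%N = false by lia.
pose L1 := Ordinal lt_L1; pose L2 := Ordinal lt_L2.
pose gxz (j : nat) := if (j == last)%N then T.*2 else j.
pose gyz (j : nat) := if (t.*2 <= j)%N then j.+1 else j.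
have gyz0 : gyz 0%N = 0%N by rewrite /gyz t2_0.
have gxz0 : gxz 0%N = 0%N by [].
have gyz1 : gyz t.*2 = last by rewrite /gyz leqnn.
have gxz1 : gxz t.*2 = t.*2 by rewrite /gxz ltn_eqF.
pose cx := cell_mon n (E 0%N) (E t.*2).
pose cy := cell_mon n (E 0%N) (E last).
pose cz := cell_mon n (E 0%N) (E T.*2).
pose F (s : 'S_(T.*2)) : P := 'X_[cx + matching_mon n (E \o gyz) s]
  - 'X_[cy + matching_mon n (E \o gxz) s] + 'X_[cz + matching_mon n E s].
(* [S] times [e x y z], the latter expanded along e. *)
pose S : P := pf_poly K n t E * ('X_[cx + cell_mon n (E last) (E T.*2)]
  - 'X_[cy + cell_mon n (E t.*2) (E T.*2)] + 'X_[cz + cell_mon n (E t.*2) (E last)]).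
pose f : P := 'X_[cx] * pf_poly K n T (E \o gyz) - 'X_[cy] * pf_poly K n T (E \o gxz)
  + 'X_[cz] * pf_poly K n T E - S.
have inner s : matching_perm s -> ~~ [forall k, (s (ord_even k) <= i0)%N] ->
    s (ord_even ord_max) = t.*2 :> nat /\ s (ord_odd ord_max) = last :> nat.
  move=> /matching_permP[lt incr]; rewrite negb_forall => /existsP[k].
  rewrite -ltnNge => gtk; have ek : k = ord_max.
    apply: ord_inj; apply/eqP; rewrite eqn_leq leq_ord leqNgt; apply/negP=> /incr.
    by have := lt ord_max; have := ltn_ord (s (ord_odd ord_max)); lia.
  by rewrite ek in gtk; have := lt ord_max; have := ltn_ord (s (ord_odd ord_max)); lia.
have fE : f = \sum_(s : 'S_(T.*2) | matching_perm s && good s) (-1) ^+ s * F s.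
  have -> : f = \sum_(s : 'S_(T.*2) | matching_perm s) (-1) ^+ s * F s - S.
    rewrite /f !mul_pf_poly -sumrB -big_split /=; congr (_ - _).
    by apply: eq_bigr => s _; rewrite /F mulrDr mulrBr.
  have -> : S = \sum_(s : 'S_(T.*2) | matching_perm s &&
                                       ~~ [forall k, (s (ord_even k) <= i0)%N])
      (-1) ^+ s * F s.
    transitivity (\sum_(s : 'S_(t.*2) | matching_perm s) (-1) ^+ lift2 s * F (lift2 s)).
      rewrite /S /pf_poly mulr_suml; apply: eq_bigr => s _.
      rewrite odd_lift2 -mulrA; congr (_ * _); rewrite /F !matching_mon_lift2 /=.
      rewrite /gxz /gyz leqnn leqnSn eqxx ltn_eqF //.
      rewrite (@eq_matching_mon t (E \o gyz) E); last first.
        by move=> j lt_j; rewrite /= /gyz leqNgt lt_j.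
      rewrite (@eq_matching_mon t (E \o gxz) E); last first.
        by move=> j lt_j; rewrite /= /gxz ltn_eqF // ltnW.
      rewrite !mpolyXD !mulrDr mulrN; congr (_ - _ + _); rewrite !mulrA; congr (_ * _).
      - by rewrite mulrC.
      - by rewrite mulrC.
      - by rewrite mulrC.
    rewrite -(sum_lift2 (fun s => (-1) ^+ s * F s)); apply: eq_bigl => s; rewrite -andbA.
    have [ms|] //= := boolP (matching_perm s); apply/andP/idP.
      move=> [/eqP es _]; rewrite negb_forall; apply/existsP; exists ord_max.
      by rewrite es; lia.
    by move=> /(inner s ms)[-> ->].
  (* Swapping the two letter positions is a sign-reversing involution on the matchings that pair 0
     with a letter. *)
  pose tau := tperm L1 L2.
  have tauN (j : 'I_(T.*2)) : (j <= i0)%N -> tau j = j.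
    by move=> le_j; rewrite tpermD // -val_eqE /=; lia.
  have tauP (j : 'I_(T.*2)) : (i0 < j)%N -> (i0 < tau j)%N.
    by rewrite /tau; case: tpermP => [->|->|//] /=; lia.
  pose Q s := matching_perm s && (i0 < s (ord_odd ord0))%N.
  have Q_even s : Q s -> forall k, (s (ord_even k) <= i0)%N.
    case/andP=> ms gt0; have [lt _] := matching_permP _ ms.
    apply/forallP; apply: contraLR gt0 => /(inner s ms)[es os].
    rewrite -leqNgt; have n0 : s (ord_odd ord0) <> s (ord_even ord_max) by move/esym/even_neq_odd.
    have n1 : s (ord_odd ord0) <> s (ord_odd ord_max).
      by move=> /perm_inj/ord_odd_inj/(congr1 val) /=; lia.
    have {}n0 : s (ord_odd ord0) <> t.*2 :> nat by move=> e; apply/n0/ord_inj; rewrite es.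
    have {}n1 : s (ord_odd ord0) <> last :> nat by move=> e; apply/n1/ord_inj; rewrite os.
    by have := ltn_ord (s (ord_odd ord0)); move: (nat_of_ord (s _)) n0 n1 => x; lia.
  have Q_tau s : Q s -> Q (s * tau)%g.
    move=> Qs; have le_even := Q_even s Qs; case/andP: Qs => ms gt0.
    have [lt incr] := matching_permP _ ms; rewrite /Q permM tauP // andbT.
    apply/matching_permP; split=> [k|k l /incr]; rewrite !permM; last by rewrite !tauN.
    rewrite tauN //; have [le|gt] := leqP (s (ord_odd k)) i0; first by rewrite tauN.
    by apply: leq_ltn_trans (le_even k) (tauP _ gt).
  have Q0 s : Q s -> s (ord_odd ord0) = L1 \/ s (ord_odd ord0) = L2.
    case/andP=> _ gt0; have lt := ltn_ord (s (ord_odd ord0)).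
    have [e|ne] := eqVneq (nat_of_ord (s (ord_odd ord0))) t.*2;
      [left|right]; apply: ord_inj => //=.
    by move: (nat_of_ord (s _)) gt0 lt ne => x; lia.
  (* In [F s] and [F (s * tau)] two of the three terms cancel each other, and the two remaining
     monomials agree. *)
  have sumQ : \sum_(s | Q s) (-1) ^+ s * F s = 0.
    pose sw (j : nat) := (if j == t.*2 then last else if j == last then t.*2 else j)%N.
    have mon_tau g s : matching_mon n (E \o g) (s * tau)%g = matching_mon n (E \o g \o sw) s.
      have tauE (j : 'I_(T.*2)) : tau j = sw j :> nat.
        rewrite /tau /sw; case: tpermP => [->|->|ne1 ne2] /=; first by rewrite eqxx.
          by rewrite eqxx gtn_eqF.
        have -> : (j == t.*2 :> nat) = false by apply/eqP => e; apply/ne1/ord_inj.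
        by have -> : (j == last :> nat) = false by apply/eqP => e; apply/ne2/ord_inj.
      by apply: eq_bigr => k _; rewrite !permM !tauE.
    have Q_tauE s : Q (s * tau)%g = Q s.
      by apply/idP/idP=> /Q_tau //; rewrite -mulgA /tau tperm2 mulg1.
    have sgn_tau s : odd_perm (s * tau)%g = ~~ odd_perm s.
      by rewrite odd_permM odd_tperm -val_eqE /= ltn_eqF // addbT.
    rewrite (bigID (fun s => s (ord_odd ord0) == L1)) /=.
    rewrite [X in _ + X](reindex_inj (mulIg tau)) /=.
    rewrite [X in _ + X](_ : _ =
      - \sum_(s | Q s && (s (ord_odd ord0) == L1)) (-1) ^+ s * F s).
      by rewrite subrr.
    rewrite -sumrN; apply: eq_big => s.
      rewrite Q_tauE permM; have [Qs|] //= := boolP (Q s).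
      have ne : (L2 == L1) = false by rewrite -val_eqE /= gtn_eqF.
      by case: (Q0 s Qs) => ->; rewrite /tau ?tpermL ?tpermR ?ne ?eqxx.
    rewrite Q_tauE => /andP[Qs ne]; have es : s (ord_odd ord0) = L1.
      by case: (Q0 s Qs) => // es; rewrite permM es /tau tpermR eqxx in ne.
    have /andP[ms _] := Qs; have /andP[mst _] := Q_tau s Qs.
    rewrite sgn_tau signrN mulNr; congr (- (_ * _)); rewrite /F.
    have -> : (cy + matching_mon n (E \o gxz) (s * tau)%g = cz + matching_mon n E (s * tau)%g)%MM.
      apply: (matching_mon_eq mst) => [j _|]; rewrite permM es /tau tpermL /=.
        by rewrite /gxz => /negPf->.
      by rewrite gxz0 /gxz eqxx addmC.
    have -> : (cx + matching_mon n (E \o gyz) s = cy + matching_mon n (E \o gxz) s)%MM.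
      apply: (matching_mon_eq ms) => [j lt_j|]; rewrite es /=.
        by move=> nj; congr E; rewrite /gyz /gxz; case: (leqP t.*2 j); case: (j =P last); lia.
      by rewrite gyz0 gxz0 gyz1 gxz1 addmC.
    rewrite subrK subrr add0r mon_tau; congr 'X_[_].
    apply: (matching_mon_eq ms) => [j lt_j|]; rewrite es /=.
      rewrite /sw /gyz => /negPf nj; rewrite nj; case: (j =P last) => [->|ne_j].
        by rewrite leqnn.
      by congr E; case: (leqP t.*2 j); lia.
    have -> : sw 0%N = 0%N by rewrite /sw; case: (0%N =P t.*2); case: (0%N =P last); lia.
    by rewrite /sw eqxx gyz0 /gyz leqnSn addmC.
  rewrite (bigID (fun s => [forall k, (s (ord_even k) <= i0)%N])) /= addrK.
  rewrite (bigID (fun s => s (ord_odd ord0) <= i0)%N) /= [X in _ + X](_ : _ = 0) ?addr0.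
    by apply: eq_bigl => s; rewrite /good -andbA; congr (_ && _); exact: andbC.
  rewrite -[RHS]sumQ; apply: eq_bigl => s; rewrite -ltnNge.
  apply/idP/idP=> [/andP[/andP[ms _] gt0]|Qs]; first by rewrite /Q ms.
  by have /andP[-> ->] := Qs; rewrite andbT; apply/forallP/Q_even.
have lt_L0 : (t.*2.-1 < T.*2)%N by lia.
(* Pairs the last two prefix positions with the two letter positions and all others consecutively; 0
   is paired with 1 because [1 < t]. *)
pose s0 : 'S_(T.*2) := tperm (Ordinal lt_L0) L1.
have s0E (j : 'I_(T.*2)) : s0 j =
    (if j == t.*2.-1 :> nat then t.*2 else if j == t.*2 :> nat then t.*2.-1 else j)%N :> nat.
  rewrite /s0; case: tpermP => [->|->|ne1 ne2] /=; first by rewrite eqxx.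
    by rewrite eqxx gtn_eqF //; lia.
  have -> : (j == t.*2.-1 :> nat) = false by apply/eqP => e; apply/ne1/ord_inj.
  by have -> : (j == t.*2 :> nat) = false by apply/eqP => e; apply/ne2/ord_inj.
apply: (gap_contradiction (N := 2) (sg := fun i => i == 1%N)
  (om := fun i => if i == 0%N then t.*2 else last)
  (g := fun i => if i == 0%N then gyz else gxz) (s0 := s0) (f := f) Galpha ordA).
- move=> i; case: (i == 0%N); rewrite /gyz /gxz; (split; first split=> j).
  + by case: (leqP t.*2 j); lia.
  + by case: (leqP t.*2 j); lia.
  + by rewrite leqnSn.
  + by case: (j =P last); lia.
  + by case: (j =P last); lia.
  + by rewrite eqxx.
- by move=> i; case: (i == 0%N); lia.
- move=> s ms /andP[le0 /forallP le_even].
  (* The two letter positions lie in distinct pairs, neither of them the first, so the later one has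
     number at least 2. *)
  have [k1|k1 e1] := @odd_position t s L1.
    by move=> /(congr1 val) /= e; have := le_even k1; rewrite e; lia.
  have [k2|k2 e2] := @odd_position t s L2.
    by move=> /(congr1 val) /= e; have := le_even k2; rewrite e; lia.
  have k1_gt0 : (0 < k1)%N.
    rewrite lt0n; apply: contraTneq le0 => k0; have <- : k1 = ord0 by apply: ord_inj.
    by rewrite e1 /=; lia.
  have k2_gt0 : (0 < k2)%N.
    rewrite lt0n; apply: contraTneq le0 => k0; have <- : k2 = ord0 by apply: ord_inj.
    by rewrite e2 /=; lia.
  have nek : nat_of_ord k1 != k2.
    apply/eqP => /ord_inj ek; move: e1; rewrite ek e2 => /(congr1 val) /=; lia.
  rewrite w2; have [lt|le] := ltnP k1 k2.
    by exists k2; [lia|rewrite e2 /=; lia].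
  by exists k1; [move: le nek; lia|rewrite e1 /=; lia].
- by apply/matching_permP; split=> [k|k l lt_kl]; rewrite !s0E /=;
    repeat case: eqP; lia.
- apply/andP; split; first by rewrite s0E /=; repeat case: eqP; lia.
  by apply/forallP=> k; rewrite s0E /=; have := ltn_ord k; repeat case: eqP; lia.
- rewrite /f; apply: ideal_genB; last first.
    rewrite /S mulrC; apply: ideal_genM.
    by apply: (@pf_poly_cogenerated t id) => // *; lia.
  apply: ideal_genD; last first.
    by apply: ideal_genM; apply: (@pf_poly_cogenerated T id) => // *; lia.
  apply: ideal_genB; apply: ideal_genM; apply: pf_poly_cogenerated.
  + by lia.
  + by move=> k l; rewrite /gyz; case: (leqP t.*2 k); case: (leqP t.*2 l); lia.
  + by move=> k; rewrite /gyz; case: (leqP t.*2 k); lia.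
  + by rewrite /gyz; case: (leqP t.*2 i0); lia.
  + by lia.
  + by move=> k l; rewrite /gxz; case: (k =P last); case: (l =P last); lia.
  + by move=> k; rewrite /gxz; case: (k =P last); lia.
  + by rewrite /gxz; case: (i0 =P last); lia.
rewrite fE; apply: eq_bigr => s _; congr (_ * _).
by rewrite !big_ord_recl big_ord0 /= addr0 /F expr0 expr1 mul1r mulN1r addrC.
Qed.

End Gap.

(** * The faces of Delta *)

Lemma G_pfaffian_consecutive (K : fieldType) n (alpha : pf_index n)
    (ord : rel 'X_{1..#|Xplus n|}) k :
    G_pfaffian K alpha -> antidiagonal K ord ->
  0 < k -> k.+2 < (pf_half alpha).*2 -> ent alpha k.+1 = (ent alpha k).+1.
Proof.
move=> Galpha ordA k_gt0 lt_k; apply/eqP; rewrite eqn_leq andbC.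
have lt_ent := @ent_lt n alpha; rewrite lt_ent ?ltnSn ?(ltnW lt_k) //=.
rewrite leqNgt; apply/negP=> gap; pose i := k.+1.
pose E j := if j < i then ent alpha j else
            if j == i then (ent alpha i).-1 else ent alpha j.-1.
have E_step j : j < (pf_half alpha).*2 -> E j < E j.+1.
  move=> lt_j; rewrite /E; have [lt_ji|lt_ij|->] := ltngtP j i.
  - have [lt_ji'|] := ltnP j.+1 i; first by apply: lt_ent; lia.
    rewrite /i in lt_ji *; move=> le_kj; have -> : j = k by lia.
    by rewrite eqxx; lia.
  - have -> : (j.+1 < i) = false by lia.
    have -> : (j.+1 == i) = false by lia.
    by apply: lt_ent; rewrite /i in lt_ij; lia.
  have -> : (i.+1 < i) = false by lia.
  have -> : (i.+1 == i) = false by lia.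
  by rewrite /i /=; lia.
have E_lt N : N < (pf_half alpha).*2 -> forall j l, j < l <= N.+1 -> E j < E l.
  move=> lt_N j l /andP[lt_jl]; rewrite -(subnKC lt_jl).
  elim: (l - j.+1) => [|m IHm] le_l; first by rewrite addn0 E_step //; lia.
  by rewrite addnS in le_l *; apply: ltn_trans (IHm (ltnW le_l)) (E_step _ _); lia.
have E_ltn j : j <= (pf_half alpha).*2 -> E j < n.
  move=> le_j; have entn := @ent_ltn n alpha; rewrite /E.
  case: (ltngtP j i) => [lt|lt|_]; try by apply: entn; rewrite /i in lt *; lia.
  by have := entn i; rewrite /i; lia.
have alphaE j : ent alpha j = if j < i then E j else E j.+1.
  by rewrite /E; case: (ltnP j i) => // le; rewrite ltnNge leqW // gtn_eqF.
(* [w] is chosen to make the length [i.+1 + w] even; counting from zero reverses the parity of the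
   position. *)
have [odd_i|even_i] := boolP (odd i).
  have [t et] : exists t, t.+1.*2 = i.+3 by exists (i./2.+1); lia.
  apply: (@even_gap K n alpha i 2 t E _ _ _ _ _ _ ord) => //.
  - by move=> j l; rewrite et; apply: E_lt; rewrite /i; lia.
  - by move=> j le_j; apply: E_ltn; rewrite /i in et; lia.
  - by rewrite /i in et; lia.
  - by rewrite et addn2.
  by move: et; rewrite /i; lia.
have [t et] : exists t, t.+1.*2 = i.+2 by exists (i./2); lia.
apply: (@odd_gap K n alpha i 1 t E _ _ _ _ _ _ ord) => //.
- by move=> j l; rewrite et; apply: E_lt; rewrite /i; lia.
- by move=> j le_j; apply: E_ltn; rewrite /i in et; lia.
- by rewrite /i in et; lia.
- by rewrite et addn1.
by move: et; rewrite /i; lia.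
Qed.

Section Faces.
Variables (n : nat) (alpha : pf_index n).
Implicit Types (b : pf_index n) (Z : {set Xplus n}).

Definition antidiag_in b Z : Prop := forall k, k < pf_half b ->
  exists2 e, e \in Z & crow e = ent b k /\ ccol e = ent b ((pf_half b).*2 - k.+1).

(** The antidiagonal is read from its innermost cell outwards, so that its inner parts are available
    as chains too. *)
Lemma antidiag_chain b Z j : antidiag_in b Z -> j < pf_half b ->
  exists p s, [/\ crow p = ent b ((pf_half b).-1 - j), ccol p = ent b (pf_half b + j),
                  path nest p s, {subset p :: s <= Z} & size s = j].
Proof.
move=> bZ; elim: j => [|j IHj] lt_j.
  have [|p Zp [rp cp]] := bZ (pf_half b).-1; first by lia.
  exists p, [::]; split=> //; [by rewrite subn0|by rewrite cp; congr ent; lia|].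
  by move=> q; rewrite inE => /eqP->.
have [p [s [rp cp ps sZ size_s]]] := IHj (ltnW lt_j).
have [|q Zq [rq cq]] := bZ ((pf_half b).-1 - j.+1); first by lia.
exists q, (p :: s); split=> //=.
- by rewrite cq; congr ent; lia.
- by rewrite ps andbT /nest rp cp rq cq !ent_lt //; lia.
- by move=> x; rewrite inE => /predU1P[->|/sZ].
by rewrite size_s.
Qed.

(** The rows read inwards followed by the columns read outwards increase, since every row is below
    every column in a chain. *)
Lemma chain_antidiag p s Z : path nest p s -> {subset p :: s <= Z} ->
  exists b, [/\ pf_half b = (size s).+1, antidiag_in b Z, ent b 0 = crow p,
                ent b (size s).*2.+1 = ccol p & 0 < size s -> ent b 1 = crow (head p s)].
Proof.
move=> ps sZ; set m := (size s).+1; pose c k := nth p (p :: s) k.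
have cZ k : k < m -> c k \in Z by move=> lt_k; apply/sZ/mem_nth.
have nestc k l : k < l < m -> nest (c k) (c l).
  move=> /andP[lt_kl lt_l]; apply: (sorted_ltn_nth nest_trans p (s := p :: s)) => //.
  by rewrite inE /= (ltn_trans lt_kl).
have rowc k l : k < l < m -> crow (c k) < crow (c l) by move/nestc/andP=> [].
have colc k l : k < l < m -> ccol (c l) < ccol (c k) by move/nestc/andP=> [].
have rowcol k l : k < m -> l < m -> crow (c k) < ccol (c l).
  move=> lt_k lt_l; case: (ltngtP k l) => [lt|lt|->]; last exact: row_lt_col.
    by apply: ltn_trans (rowc k l _) (row_lt_col _); rewrite lt.
  by apply: ltn_trans (row_lt_col _) (colc l k _); rewrite lt.
pose h k := if k < m then crow (c k) else ccol (c (m.*2 - k.+1)).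
have [//|k l /andP[lt_kl lt_l]|k lt_k|b [half_b entb]] := @pf_index_exists n m h.
- rewrite /h; case: (ltnP k m) => lt_km; case: (ltnP l m) => lt_lm.
  + by rewrite rowc // lt_kl.
  + by rewrite rowcol //; lia.
  + by lia.
  + by apply: colc; lia.
- by rewrite /h; case: ifP => _; [apply: ltn_trans (row_lt_col _) (col_ltn _)|apply: col_ltn].
exists b; split=> //.
- move=> k; rewrite half_b => lt_k; exists (c k); first exact: cZ.
  rewrite !entb; try lia; rewrite /h lt_k ltnNge (_ : m <= _); last by lia.
  by split=> //=; congr (ccol (c _)); lia.
- by rewrite entb.
- by rewrite entb /h /m; [rewrite ltnNge (_ : _ <= _); [rewrite (_ : _ - _ = 0); [|lia]|lia]|lia].
move=> s_gt0; rewrite entb /h /m; last by lia.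
by rewrite ltnS s_gt0 /c /=; case: (s) s_gt0.
Qed.

(** Consecutive entries leave only the first, second and last to compare. The first is the row of
    the outermost cell, the last its column; the second is the row of the next cell, or the column
    if there is just one cell. *)
Lemma facesP Z :
    (forall k, 0 < k -> k.+2 < (pf_half alpha).*2 ->
       ent alpha k.+1 = (ent alpha k).+1) ->
  (forall b, ~ pf_le alpha b -> ~ antidiag_in b Z) <->
  ladder_complex (pf_half alpha) (ent alpha 1) (ent alpha (pf_half alpha).*2.-1)
    (ent alpha 0) Z.
Proof.
have s_gt0 := pf_half_gt0 alpha; set s := pf_half alpha in s_gt0 *.
set d := ent alpha s.*2.-1; move=> consec.
have entE k : 0 < k < s.*2.-1 -> ent alpha k = ent alpha 1 + k.-1.
  case: k => // k; elim: k => [|k IHk] lt_k; first by rewrite addn0.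
  by rewrite consec ?IHk //=; lia.
split=> [noZ|[Zp Zc Zle] b badb bZ].
  have bad p t : path nest p t -> {subset p :: t <= Z} ->
      ~ ([\/ s <= size t, crow p < ent alpha 0,
            size t = s.-1 /\ ccol p < d
          | size t = 0 /\ ccol p < ent alpha 1] \/
         0 < size t /\ crow (head p t) < ent alpha 1).
    move=> pt tZ; have [b [half_b bZ b0 b_last b1]] := chain_antidiag pt tZ.
    have nbad : ~ ~ pf_le alpha b by move=> /noZ.
    move=> cases; apply: nbad; apply/not_pf_leP; rewrite half_b -/s.
    case: cases => [[le|lt|[es lt]|[es lt]]|[gt0 lt]]; first by left.
    - by right; exists 0; rewrite // b0.
    - right; exists (size t).*2.+1; first by rewrite doubleS.
      rewrite b_last; suff -> : (size t).*2.+1 = s.*2.-1 by [].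
      by rewrite es; lia.
    - right; exists 1; first by lia.
      by have -> : ent b 1 = ccol p by rewrite -b_last es.
    - by right; exists 1; rewrite ?b1 //; lia.
  have sub1 p : p \in Z -> {subset [:: p] <= Z} by move=> Zp q; rewrite inE => /eqP->.
  split=> [p Zp|p q Zp Zq npq|p t pt tZ].
  - split; rewrite leqNgt; apply/negP=> lt.
      by apply: (bad p [::]) => //; [apply: sub1|left; constructor 2].
    by apply: (bad p [::]) => //; [apply: sub1|left; constructor 4].
  - rewrite leqNgt; apply/negP=> lt; apply: (bad p [:: q]); rewrite /= ?npq //.
      by move=> x; rewrite !inE => /orP[] /eqP->.
    by right.
  rewrite /step_cap; case: ifP => lt_d; rewrite ltnNge; apply/negP=> le.
    apply: (bad p t) => //; move: le; rewrite leq_eqVlt => /predU1P[es|lt].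
      by left; constructor 3.
    by left; constructor 1; move: lt; case: (s) s_gt0.
  by apply: (bad p t) => //; left; constructor 1.
have chain := antidiag_chain bZ; have tb := pf_half_gt0 b.
have row_lt k l : k < l < (pf_half b).*2 -> ent b k < ent b l := @ent_lt n b k l.
have [e0 Ze0 [re0 ce0]] := bZ 0 tb; have [r0 c0] := Zp e0 Ze0.
have /not_pf_leP[lt|[k lt_k lt_ent]] := badb.
  have [p [t [_ _ pt tZ size_t]]] := chain _ lt.
  by have := Zle p t pt tZ; rewrite size_t /step_cap -/s; case: ifP => _; lia.
have le_half : pf_half b <= s.
  rewrite leqNgt; apply/negP=> /chain[p [t [_ _ pt tZ size_t]]].
  by have := Zle p t pt tZ; rewrite size_t /step_cap; case: ifP => _; lia.
have ge1 : ent alpha 1 <= ent b 1.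
  have [b1|b_gt1] := leqP (pf_half b) 1.
    by move: c0; rewrite ce0 (_ : _ - 1 = 1) //; lia.
  have [e1 Ze1 [re1 ce1]] := bZ 1 b_gt1; rewrite -re1; apply: (Zc e0) => //.
  by rewrite /nest re0 re1 ce0 ce1 !row_lt //; lia.
case: k => [|k] in lt_k lt_ent *; first by rewrite -re0 ltnNge r0 in lt_ent.
(* In the middle [alpha] grows by exactly one and [b] by at least one, so [ge1] suffices. Otherwise
   [k.+1] is the last position, [b] has full length, and its chain of [s] cells starts left of
   column [d]. *)
have [lt_ks|ge_ks] := ltnP k.+1 s.*2.-1.
  rewrite entE ?lt_ks // in lt_ent; have := @ent_le_add n b 1 k.+1.
  by rewrite /= lt_k => /(_ isT); lia.
have [p [t [_ cp pt tZ size_t]]] := chain (pf_half b).-1 ltac:(lia).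
have := Zle p t pt tZ; rewrite /step_cap size_t cp.
rewrite (_ : ent b _ = ent b k.+1); last by congr ent; lia.
rewrite (_ : d = ent alpha k.+1) ?lt_ent; first by lia.
by rewrite /d; congr ent; lia.
Qed.

End Faces.

Theorem proposition3p12 (K : fieldType) (n : nat) (alpha : pf_index n)
    (ord : rel 'X_{1..#|Xplus n|}) :
  G_pfaffian K alpha -> antidiagonal K ord -> shellable (Delta K ord alpha).
Proof.
move=> Galpha ordA; have s_gt0 := pf_half_gt0 alpha.
have lt01 : ent alpha 0 < ent alpha 1 by apply: ent_lt; lia.
have c_ltn : ent alpha 1 < n by apply: ent_ltn; lia.
have s1 : pf_half alpha = 1 -> ent alpha (pf_half alpha).*2.-1 <= ent alpha 1 by move->.
have le_r : ent alpha 0 <= (ent alpha 1).-1 by lia.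
have [k shk] := ladder_complex_pure_shellable s_gt0
  (leq_ltn_trans (leq0n _) lt01) c_ltn s1 le_r.
apply: (shellable_pure_shellable (d := k)); apply: eq_pure_shellable shk => Z.
have consec j : 0 < j -> j.+2 < (pf_half alpha).*2 ->
    ent alpha j.+1 = (ent alpha j).+1 by apply: G_pfaffian_consecutive Galpha ordA.
exact: iff_trans (iff_sym (facesP Z consec)) (iff_sym (DeltaP Z Galpha ordA)).
Qed.
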